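(* Let $d\mu(x)=e^{-V(x)}dx$ be a probability measure on $\mathbb R^d$. Assume that there exist $\lambda\ge0$ and an even strictly convex function $c:\mathbb R^d\to\mathbb R^+$ with $c(0)=0$ such that for all $x,u\in\mathbb R^d$, $$V(x+u)\ge V(x)+u\cdot\nabla V(x)-\lambda c(u).$$ If there exists $\varepsilon>0$ such that $$\int_{\mathbb R^{2d}}e^{(\lambda+\varepsilon)c(y-x)}d\mu(x)\,d\mu(y)<+\infty,$$ then there exist $K_1,K_3\ge0$ and $K_2>0$ such that every nonnegative smooth function $f$ verifies $$\mathrm{Ent}_\mu(f^2)\le K_1\int f^2c^*\left(\frac{\nabla f}{K_2f}\right)d\mu+K_3\int f^2d\mu.$$
   Context: $V$ is differentiable. $\mathrm{Ent}_\mu(f^2)=\int f^2\log\left(f^2/\int f^2d\mu\right)d\mu$, and $c^*(x)=\sup_{y\in\mathbb R^d}(\langle x,y\rangle-c(y))$ is the convex conjugate of $c$ (possibly $+\infty$). The integrand $f^2c^*(\nabla f/(K_2f))$ is taken to be $0$ where $f=0$. *)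

(* Defs.v *)
From HB Require Import structures.
From mathcomp Require Import all_boot all_order all_algebra.
From mathcomp Require Import all_classical all_reals all_analysis.

Set Implicit Arguments.
Unset Strict Implicit.
Unset Printing Implicit Defensive.

Import Order.TTheory GRing.Theory Num.Theory.
Import numFieldNormedType.Exports.

Local Open Scope classical_set_scope.
Local Open Scope ring_scope.

(* R^n is 'rV[R]_n. Its sigma-algebra is generated by the coordinate maps,     *)
(* i.e. it is the product (equivalently, the Borel) sigma-algebra, as in the   *)
(* library's structure on n.-tuple T.                                          *)
Section measurable_rV.
Context {R : realType}.
Variable n : nat.

Let coors : 'I_n -> 'rV[R]_n -> R := fun i x => x ord0 i.

Let rV_set0 : g_sigma_preimage coors set0.
Proof. exact: sigma_algebra0. Qed.

Let rV_setC A : g_sigma_preimage coors A -> g_sigma_preimage coors (~` A).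
Proof. exact: sigma_algebraC. Qed.

Let rV_bigcup (F : (set 'rV[R]_n)^nat) :
  (forall i, g_sigma_preimage coors (F i)) ->
  g_sigma_preimage coors (\bigcup_i (F i)).
Proof. exact: sigma_algebra_bigcup. Qed.

HB.instance Definition _ := @isMeasurable.Build default_measure_display
  'rV[R]_n (g_sigma_preimage coors) rV_set0 rV_setC rV_bigcup.

End measurable_rV.

Section measurable_rV_theory.
Context {R : realType}.

Lemma measurable_coord n (i : 'I_n) :
  measurable_fun [set: 'rV[R]_n] (fun x : 'rV[R]_n => x ord0 i).
Proof.
move=> _ Y mY; rewrite setTI; apply: sub_sigma_algebra => /=.
rewrite -bigcup_seq/=; exists i => /=; first by rewrite mem_index_enum.
by exists Y => //; rewrite setTI.
Qed.

Lemma measurable_fun_rVP d (T : measurableType d) n (f : T -> 'rV[R]_n) :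
  (forall i, measurable_fun [set: T] (fun t => f t ord0 i)) ->
  measurable_fun [set: T] f.
Proof.
move=> mf _ A mA; rewrite setTI.
suff : (g_sigma_preimage (fun (i : 'I_n) (x : 'rV[R]_n) => x ord0 i)) `<=`
       [set B | measurable (f @^-1` B)] by apply.
apply: smallest_sub.
  split => /=.
  - by rewrite preimage_set0.
  - by move=> B mB; rewrite setTD preimage_setC; exact: measurableC.
  - by move=> F mF; rewrite preimage_bigcup; exact: bigcup_measurable.
rewrite -bigcup_seq; apply: bigcup_sub => i _ B [C mC <-] /=.
by rewrite setTI; have := mf i measurableT _ mC; rewrite setTI.
Qed.

End measurable_rV_theory.

(* Lebesgue measure on R^n, as an iterated product of the one-dimensional one  *)
(* transported along R * R^n ~ R^(n+1).                                        *)
Section lebesgue_rV.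
Context {R : realType}.

Definition rV_cons n (p : measurableTypeR R * 'rV[R]_n) : 'rV[R]_n.+1 :=
  row_mx (p.1%:M : 'M[R]_1) p.2.

Definition rV_uncons n (v : 'rV[R]_n.+1) : measurableTypeR R * 'rV[R]_n :=
  (v ord0 ord0, \row_i v ord0 (lift ord0 i)).

Lemma rV_cons0 n (p : measurableTypeR R * 'rV[R]_n) : rV_cons p ord0 ord0 = p.1.
Proof.
rewrite /rV_cons.
have -> : ord0 = lshift n (ord0 : 'I_1) :> 'I_n.+1 by apply/val_inj.
by rewrite (@row_mxEl _ 1 1 n) mxE eqxx mulr1n.
Qed.

Lemma rV_consS n (p : measurableTypeR R * 'rV[R]_n) (i : 'I_n) :
  rV_cons p ord0 (lift ord0 i) = p.2 ord0 i.
Proof.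
rewrite /rV_cons.
have -> : lift ord0 i = rshift 1 i :> 'I_n.+1 by apply/val_inj.
by rewrite (@row_mxEr _ 1 1 n).
Qed.

Lemma rV_consK n : cancel (@rV_cons n) (@rV_uncons n).
Proof.
move=> p; rewrite /rV_uncons rV_cons0 (_ : \row_i _ = p.2) -?surjective_pairing//.
by apply/rowP => i; rewrite mxE rV_consS.
Qed.

Lemma measurable_rV_cons n :
  measurable_fun [set: measurableTypeR R * 'rV[R]_n] (@rV_cons n).
Proof.
apply: measurable_fun_rVP => i; case: (unliftP ord0 i) => [j|] ->.
  rewrite (_ : (fun _ => _) = (fun v : 'rV[R]_n => v ord0 j) \o snd).
    by apply: measurableT_comp => //; exact: measurable_coord.
  by apply/funext => p /=; rewrite rV_consS.
rewrite (_ : (fun _ => _) = fst)//.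
by apply/funext => p /=; rewrite rV_cons0.
Qed.

Lemma measurable_rV_uncons n : measurable_fun setT (@rV_uncons n).
Proof.
apply/measurable_fun_pairP; split => /=.
  exact: measurable_coord.
apply: measurable_fun_rVP => i /=.
rewrite (_ : (fun _ => _) = (fun v : 'rV[R]_n.+1 => v ord0 (lift ord0 i))).
  exact: measurable_coord.
by apply/funext => v /=; rewrite mxE.
Qed.

Section cons.
Variables (n : nat) (m : {sigma_finite_measure set 'rV[R]_n -> \bar R}).

Let leb_prod : {measure set (measurableTypeR R * 'rV[R]_n)%type -> \bar R} :=
  (@lebesgue_measure R \x m)%E.

Definition lebesgue_cons : set 'rV[R]_n.+1 -> \bar R :=
  pushforward (@lebesgue_measure R \x m)%E (@rV_cons n).

Let lebesgue_cons0 : lebesgue_cons set0 = 0%E.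
Proof. by rewrite /lebesgue_cons /pushforward preimage_set0 measure0. Qed.

Let lebesgue_cons_ge0 A : (0 <= lebesgue_cons A)%E.
Proof. exact: (measure_ge0 leb_prod). Qed.

Let lebesgue_cons_sigma_additive : semi_sigma_additive lebesgue_cons.
Proof.
move=> F mF tF mUF; rewrite /lebesgue_cons /pushforward preimage_bigcup.
have mP B : measurable B -> measurable (@rV_cons n @^-1` B).
  by move=> mB; rewrite -[X in measurable X]setTI; exact: measurable_rV_cons.
apply: (@measure_semi_sigma_additive _ _ _ leb_prod
  (fun k => @rV_cons n @^-1` F k)) => [i||].
- exact: mP.
- apply/trivIsetP => /= i j _ _ ij; rewrite -preimage_setI.
  by move/trivIsetP : tF => /(_ _ _ _ _ ij) ->//; rewrite preimage_set0.
- by rewrite -preimage_bigcup; exact: mP.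
Qed.

HB.instance Definition _ := isMeasure.Build _ _ _ lebesgue_cons
  lebesgue_cons0 lebesgue_cons_ge0 lebesgue_cons_sigma_additive.

Lemma lebesgue_cons_sigma_finite : sigma_finite setT lebesgue_cons.
Proof.
have /sigma_finiteP[F [FT ndF Foo]] := sigma_finiteT (@lebesgue_measure R).
have /sigma_finiteP[G [GT ndG Goo]] := sigma_finiteT m.
exists (fun k => @rV_uncons n @^-1` (F k `*` G k)).
  rewrite -preimage_bigcup -[LHS](@preimage_setT _ _ (@rV_uncons n)).
  congr (_ @^-1` _); rewrite -setXTT FT GT predeqE => -[x y]; split.
    move=> [/= [i _ Fx] [j _ Gy]]; exists (maxn i j) => //; split.
    - by move: x Fx; exact/subsetPset/ndF/leq_maxl.
    - by move: y Gy; exact/subsetPset/ndG/leq_maxr.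
  by move=> [i _ []/= ? ?]; split; exists i.
move=> k; have [mF Fk] := Foo k; have [mG Gk] := Goo k; split.
  rewrite -[X in measurable X]setTI; apply: measurable_rV_uncons => //.
  exact: measurableX.
rewrite /lebesgue_cons /pushforward -comp_preimage.
rewrite (_ : _ \o _ = id); last by apply/funext => p /=; rewrite rV_consK.
by rewrite preimage_id /= product_measure1E// lte_mul_pinfty// ge0_fin_numE.
Qed.

HB.instance Definition _ := Measure_isSigmaFinite.Build _ _ _ lebesgue_cons
  lebesgue_cons_sigma_finite.

End cons.

(* For n = 0 the space is a single point, of mass 1.                           *)
Fixpoint lebesgue_rV n : {sigma_finite_measure set 'rV[R]_n -> \bar R} :=
  if n is n'.+1 then lebesgue_cons (lebesgue_rV n') else \d_(0 : 'rV[R]_0).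

Lemma lebesgue_rV_box n (a b : 'rV[R]_n) : (forall i, a ord0 i <= b ord0 i) ->
  lebesgue_rV n [set x | forall i, a ord0 i <= x ord0 i <= b ord0 i] =
  (\prod_(i < n) (b ord0 i - a ord0 i))%:E.
Proof.
elim: n a b => [a b _|n IH a b ab] /=.
  rewrite big_ord0 diracE (_ : _ \in _)//.
  by rewrite inE /= => -[].
pose tl (v : 'rV[R]_n.+1) : 'rV[R]_n := \row_i v ord0 (lift ord0 i).
rewrite /lebesgue_cons /pushforward.
pose A : set (measurableTypeR R) := `[a ord0 ord0, b ord0 ord0]%classic.
pose B := [set x : 'rV[R]_n | forall i, tl a ord0 i <= x ord0 i <= tl b ord0 i].
transitivity ((@lebesgue_measure R \x lebesgue_rV n) (A `*` B))%E.
  congr product_measure1.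
  apply/seteqP; split => -[x v] /=.
    move=> h; split.
      by rewrite /A /= in_itv /=; have := h ord0; rewrite rV_cons0.
    by move=> i; have := h (lift ord0 i); rewrite rV_consS !mxE.
  move=> []; rewrite /A /= in_itv /= => h0 h i; case: (unliftP ord0 i) => [j|] ->.
    by have := h j; rewrite rV_consS !mxE.
  by rewrite rV_cons0.
have mB : measurable B.
  rewrite (_ : B = \bigcap_(i in [set: 'I_n])
     ((fun x : 'rV[R]_n => x ord0 i) @^-1` `[tl a ord0 i, tl b ord0 i])).
    apply: fin_bigcap_measurable => // i _.
    by rewrite -[X in measurable X]setTI; exact: measurable_coord.
  apply/seteqP; split => x /= h i; first by move=> _ /=; rewrite in_itv /= h.
  by have := h i I; rewrite /= in_itv.
have mA : measurable A by exact: measurable_itv.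
transitivity (@lebesgue_measure R A * lebesgue_rV n B)%E.
  exact: product_measure1E.
have -> : @lebesgue_measure R A = (b ord0 ord0 - a ord0 ord0)%:E.
  rewrite (@lebesgue_measure_itv R `[a ord0 ord0, b ord0 ord0])/= lte_fin.
  case: ltP => // ba; congr EFin; apply/eqP; rewrite eq_sym subr_eq0.
  by rewrite eq_le ba ab.
rewrite big_ord_recl EFinM; congr (_ * _)%E.
rewrite IH => [|i]; last by rewrite !mxE.
by congr EFin; apply: eq_bigr => i _; rewrite !mxE.
Qed.

End lebesgue_rV.

Section notions.
Context {R : realType} {d : nat}.
Implicit Types (f V c : 'rV[R]_d -> R) (x y u : 'rV[R]_d).

Definition dotv x y : R := \sum_(i < d) x ord0 i * y ord0 i.

Definition partial (i : 'I_d) f : 'rV[R]_d -> R := 'D_(delta_mx ord0 i) f.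

Definition grad f x : 'rV[R]_d := \row_i partial i f x.

(* C^infinity: every iterated partial derivative is everywhere differentiable. *)
Definition smooth f :=
  forall (s : seq 'I_d) x, differentiable (foldr partial f s) x.

Definition strictly_convex c :=
  forall x y (t : R), x != y -> 0 < t < 1 ->
    c (t *: x + (1 - t) *: y) < t * c x + (1 - t) * c y.

Definition convex_conjugate c x : \bar R :=
  ereal_sup [set (dotv x y - c y)%:E | y in [set: 'rV[R]_d]].

(* Extended-real arithmetic gives 0 * lne 0 = 0 * -oo = 0, the usual          *)
(* convention 0 log 0 = 0. If the total mass of g is +oo, then                 *)
(* lne (g / +oo) = -oo and Ent mu g has no meaning of its own; in a bound      *)
(* Ent mu g <= ... + K * \int[mu] g the right-hand side is +oo as soon as      *)
(* 0 < K.                                                                      *)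
Definition Ent (mu : set 'rV[R]_d -> \bar R) (g : 'rV[R]_d -> R) : \bar R :=
  (\int[mu]_x ((g x)%:E * lne ((g x)%:E / \int[mu]_z (g z)%:E)))%E.

End notions.

(* Main.v *)
Require Import Defs.
From mathcomp Require Import all_boot all_order all_algebra.
From mathcomp Require Import all_classical all_reals all_analysis.
From mathcomp Require Import measurable_realfun ring lra.

(** The classical proof transports the probability density proportional to f^2
    onto mu by an optimal map and integrates the logarithm of the Jacobian
    equation by parts.  Because the bound has a defect term K3 * int f^2, the
    target of the transport is free, and a much simpler one suffices: the
    uniform measure on a box with sides [p_i, q_i].  The triangular map onto
    such a box is explicit, its i-th component being p_i + (q_i - p_i) * F_i with
    F_i a conditional distribution function, and all that matters about it is
    that its i-th component takes values in [p_i, q_i].  So no map in several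
    variables is needed: the inequality is proved on lines and tensorized.

    On a line ([entropy_le_line]), for a positive density g on [a, b] of mass Z,
    T = p + (q - p) F / Z satisfies T' = (q - p) g / Z, so that
    ln (g (q - p) / Z) <= T' - 1, and an integration by parts gives
      int g ln (g / Z) + Z ln (q - p) <= int max ((s - p) g', (s - q) g').
    The boundary terms have the right sign since [p, q] lies inside [a, b]; this
    is why hard truncation to cubes costs nothing.  Entropy is subadditive over
    the coordinates ([entropy_le_sum_lines]), whence on a cube Q containing the
    box ([entropy_le_drift])
      int_Q G ln (G / Z) + Z sum_i ln (q_i - p_i) <= int_Q drift G,
    where drift G at x is the largest (x - v) . grad G x over the vertices v.

    Take G = (f^2 + eta) e^(-V) and a vertex v.  The lower bound on V with
    u = v - x turns - (x - v) . grad V x into V v - V x + lambda c (v - x); there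
    are finitely many vertices, so V v is bounded, and V x cancels against the
    logarithm of e^(-V).  Fenchel-Young splits (x - v) . grad (f^2) into
    (eps / 2) f^2 c (v - x) and the term with the conjugate of c.  What remains is
    at most (lambda + eps / 2) (f^2 + eta) c (v - x), which the duality between
    entropy and exponential moments bounds by a fraction dl < 1 of the entropy and
    dl * Z * e^((lambda + eps) c (v - x)) ([drift_pointwise], [cube_bound]).

    The exponential moment hypothesis makes the last term integrable when v is
    outside a null set, and every null set misses the vertices of some
    nondegenerate box ([negligible_box_vertices], [exists_good_box]).  Finally
    eta tends to 0 ([entropy_regularization]) and the cubes increase to the whole
    space ([entropy_exhaustion]). *)

Import Order.TTheory GRing.Theory Num.Theory.
Import numFieldNormedType.Exports.

Local Open Scope classical_set_scope.
Local Open Scope ring_scope.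

Set Implicit Arguments.
Unset Strict Implicit.
Unset Printing Implicit Defensive.

(** * Bounded functions vanishing outside a set of finite measure *)

(** On a set of finite measure these functions are integrable, and they are
    stable under slicing and partial integration; working with them keeps all
    integrals real-valued and all uses of Fubini free of side conditions. *)
Definition bounded_on {d} {T : measurableType d} {R : realType}
    (Q : set T) (f : T -> R) :=
  measurable_fun setT f /\ exists M, forall x, `|f x| <= M * \1_Q x.

Section bounded_on_lemmas.
Context {d} {T : measurableType d} {R : realType}.
Variables (m : {measure set T -> \bar R}) (Q : set T).
Hypotheses (mQ : measurable Q) (Qfin : (m Q < +oo)%E).
Implicit Types f g : T -> R.

Lemma bounded_on_integrable f : bounded_on Q f ->
  m.-integrable setT (EFin \o f).
Proof.
move=> [mf [M fM]].
apply: (@le_integrable _ _ _ m _ measurableT _ (EFin \o (fun x => M * \1_Q x))).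
- exact/measurable_EFinP.
- move=> x _ /=; rewrite lee_fin (le_trans (fM x))// ler_norm//.
- apply/integrableP; split.
    by apply/measurable_EFinP; apply: measurable_funM.
  apply: (@le_lt_trans _ _ (\int[m]_x (`|M|%:E * (\1_Q x)%:E))%E).
    apply: ge0_le_integral => //.
    - apply: measurableT_comp => //; apply/measurable_EFinP.
      exact: measurable_funM.
    - by apply: measurable_funeM; exact/measurable_EFinP.
    - by move=> x _ /=; rewrite lee_fin normrM [X in _ * X]ger0_norm.
  rewrite ge0_integralZl//; last exact/measurable_EFinP.
  by rewrite integral_indic// setIT lte_mul_pinfty.
Qed.

Lemma bounded_on_out f x : bounded_on Q f -> ~ Q x -> f x = 0.
Proof.
move=> [_ [M /(_ x)]] + nQ; rewrite indicE memNset// mulr0 normr_le0.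
by move/eqP.
Qed.

Lemma bounded_onD f g : bounded_on Q f -> bounded_on Q g ->
  bounded_on Q (fun x => f x + g x).
Proof.
move=> [mf [M fM]] [mg [N gN]]; split; first exact: measurable_funD.
by exists (M + N) => x; rewrite mulrDl (le_trans (ler_normD _ _))// lerD.
Qed.

Lemma bounded_onN f : bounded_on Q f -> bounded_on Q (fun x => - f x).
Proof.
move=> [mf [M fM]]; split; first exact: measurableT_comp.
by exists M => x; rewrite normrN.
Qed.

Lemma bounded_onB f g : bounded_on Q f -> bounded_on Q g ->
  bounded_on Q (fun x => f x - g x).
Proof. by move=> bf bg; apply: bounded_onD => //; exact: bounded_onN. Qed.

Lemma bounded_on0 : bounded_on Q (fun=> 0 : R).
Proof. by split => //; exists 0 => x; rewrite normr0 mul0r. Qed.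

Lemma bounded_on_sum (I : Type) (s : seq I) (F : I -> T -> R) :
  (forall i, bounded_on Q (F i)) -> bounded_on Q (fun x => \sum_(i <- s) F i x).
Proof.
move=> bF; elim: s => [|i s IH].
  under eq_fun do rewrite big_nil; exact: bounded_on0.
by under eq_fun do rewrite big_cons; exact: bounded_onD.
Qed.

Lemma bounded_onM f g K : bounded_on Q f -> measurable_fun setT g ->
  (forall x, Q x -> `|g x| <= K) -> bounded_on Q (fun x => f x * g x).
Proof.
move=> bf mg gK; have [mf [M fM]] := bf; split; first exact: measurable_funM.
exists (M * K) => x; have [Qx|nQx] := pselect (Q x).
  have := fM x; rewrite indicE mem_set// !mulr1 => fMx.
  by rewrite normrM ler_pM// gK.
by rewrite (bounded_on_out bf nQx) mul0r normr0 indicE memNset// mulr0.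
Qed.

Lemma bounded_onZ f k : bounded_on Q f -> bounded_on Q (fun x => k * f x).
Proof.
move=> bf; under eq_fun do rewrite mulrC.
by apply: (@bounded_onM _ _ `|k|) => //; exact: measurable_cst.
Qed.

Lemma bounded_on_indic g K : measurable_fun setT g ->
  (forall x, Q x -> `|g x| <= K) -> bounded_on Q (fun x => \1_Q x * g x).
Proof.
move=> mg gK; apply: bounded_onM gK => //; split => //.
by exists 1 => x; rewrite mul1r ger0_norm.
Qed.

Lemma measurable_ln_comp f : measurable_fun setT f ->
  measurable_fun setT (fun x => ln (f x)).
Proof. by move=> mf; apply: measurableT_comp => //; exact: measurable_ln. Qed.

Lemma bounded_on_fin_num f : bounded_on Q f -> (\int[m]_x (f x)%:E)%E \is a fin_num.
Proof. by move=> bf; apply: integrable_fin_num => //; exact: bounded_on_integrable. Qed.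

Lemma bounded_on_EFin f : bounded_on Q f ->
  (\int[m]_x f x)%:E = (\int[m]_x (f x)%:E)%E.
Proof. by move=> bf; rewrite /Rintegral fineK// bounded_on_fin_num. Qed.

Lemma bintD f g : bounded_on Q f -> bounded_on Q g ->
  \int[m]_x (f x + g x) = \int[m]_x f x + \int[m]_x g x.
Proof. by move=> bf bg; rewrite RintegralD//; exact: bounded_on_integrable. Qed.

Lemma bintB f g : bounded_on Q f -> bounded_on Q g ->
  \int[m]_x (f x - g x) = \int[m]_x f x - \int[m]_x g x.
Proof. by move=> bf bg; rewrite RintegralB//; exact: bounded_on_integrable. Qed.

Lemma bintZ k f : bounded_on Q f ->
  \int[m]_x (k * f x) = k * \int[m]_x f x.
Proof. by move=> bf; rewrite RintegralZl//; exact: bounded_on_integrable. Qed.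

Lemma bint_le f g : bounded_on Q f -> bounded_on Q g -> (forall x, f x <= g x) ->
  \int[m]_x f x <= \int[m]_x g x.
Proof.
by move=> bf bg fg; apply: le_Rintegral => //; exact: bounded_on_integrable.
Qed.

Lemma bint_sum (I : Type) (s : seq I) (F : I -> T -> R) :
  (forall i, bounded_on Q (F i)) ->
  \int[m]_x (\sum_(i <- s) F i x) = \sum_(i <- s) \int[m]_x F i x.
Proof.
move=> bF; elim: s => [|i s IH].
  under eq_Rintegral do rewrite big_nil.
  by rewrite big_nil Rintegral_cst// mul0r.
under eq_Rintegral do rewrite big_cons.
by rewrite big_cons bintD ?IH//; exact: bounded_on_sum.
Qed.

Lemma bint_indic : \int[m]_x (\1_Q x : R) = fine (m Q).
Proof. by rewrite /Rintegral integral_indic// setIT. Qed.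

Lemma bounded_on_indic1 : bounded_on Q (\1_Q : T -> R).
Proof. by split => //; exists 1 => x; rewrite mul1r ger0_norm. Qed.

End bounded_on_lemmas.

Section bounded_on_product.
Context {d1 d2} {T1 : measurableType d1} {T2 : measurableType d2} {R : realType}.
Variables (m1 : {sigma_finite_measure set T1 -> \bar R}).
Variables (m2 : {sigma_finite_measure set T2 -> \bar R}).
Variables (A : set T1) (B : set T2).
Hypotheses (mA : measurable A) (mB : measurable B).
Hypotheses (Afin : (m1 A < +oo)%E) (Bfin : (m2 B < +oo)%E).
Implicit Types F : T1 * T2 -> R.

Let indicX x y : \1_(A `*` B) (x, y) = \1_A x * \1_B y :> R.
Proof. by rewrite !indicE in_setX/= -natrM mulnb. Qed.

Lemma setX_lty : ((m1 \x m2) (A `*` B) < +oo)%E.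
Proof.
by rewrite product_measure1E// lte_mul_pinfty// ge0_fin_numE.
Qed.

Lemma bounded_on_slice1 F x : bounded_on (A `*` B) F -> bounded_on B (fun y => F (x, y)).
Proof.
move=> [mF [M FM]]; split; first exact: measurableT_comp.
exists `|M| => y; rewrite (le_trans (FM _))// indicX mulrA ler_wpM2r//.
by rewrite (le_trans (ler_norm _))// normrM ler_piMr// ger0_norm// indicE.
Qed.

Lemma bounded_on_slice2 F y : bounded_on (A `*` B) F -> bounded_on A (fun x => F (x, y)).
Proof.
move=> [mF [M FM]]; split; first exact: measurableT_comp.
exists `|M| => x; rewrite (le_trans (FM _))// indicX mulrCA mulrC ler_wpM2r//.
by rewrite (le_trans (ler_norm _))// normrM ler_piMr// ger0_norm// indicE.
Qed.

Lemma bounded_on_marginal1 F : bounded_on (A `*` B) F ->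
  bounded_on A (fun x => \int[m2]_y F (x, y)).
Proof.
move=> bF; have [mF [M FM]] := bF; split.
  apply: measurableT_comp => //.
  apply: (@measurable_fubini_F _ _ _ _ _ m1 m2 (EFin \o F)).
  by apply: (@bounded_on_integrable _ _ _ _ (A `*` B)); rewrite ?setX_lty//;
    exact: measurableX.
exists (M * fine (m2 B)) => x.
have bs := bounded_on_slice1 x bF.
have bi := bounded_on_integrable mB Bfin bs.
rewrite (le_trans (le_normr_Rintegral measurableT bi))//.
have -> : M * fine (m2 B) * \1_A x = \int[m2]_y (M * \1_A x * \1_B y).
  rewrite (@bintZ _ _ _ m2 B)//; last exact: bounded_on_indic1.
  by rewrite bint_indic// mulrAC.
apply: (@bint_le _ _ _ m2 B) => //.
- by split; [apply: measurableT_comp => //; exact: bs.1|];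
    have [N fN] := bs.2; exists N => y; rewrite normr_id.
- by apply: bounded_onZ; exact: bounded_on_indic1.
- by move=> y; rewrite -mulrA -indicX.
Qed.

Lemma bounded_on_marginal2 F : bounded_on (A `*` B) F ->
  bounded_on B (fun y => \int[m1]_x F (x, y)).
Proof.
move=> bF; have [mF [M FM]] := bF; split.
  apply: measurableT_comp => //.
  apply: (@measurable_fubini_G _ _ _ _ _ m1 m2 (EFin \o F)).
  by apply: (@bounded_on_integrable _ _ _ _ (A `*` B)); rewrite ?setX_lty//;
    exact: measurableX.
exists (M * fine (m1 A)) => y.
have bs := bounded_on_slice2 y bF.
have bi := bounded_on_integrable mA Afin bs.
rewrite (le_trans (le_normr_Rintegral measurableT bi))//.
have -> : M * fine (m1 A) * \1_B y = \int[m1]_x (M * \1_B y * \1_A x).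
  rewrite (@bintZ _ _ _ m1 A)//; last exact: bounded_on_indic1.
  by rewrite bint_indic// mulrAC.
apply: (@bint_le _ _ _ m1 A) => //.
- by split; [apply: measurableT_comp => //; exact: bs.1|];
    have [N fN] := bs.2; exists N => x; rewrite normr_id.
- by apply: bounded_onZ; exact: bounded_on_indic1.
- by move=> x; rewrite -mulrA [X in M * X]mulrC -indicX.
Qed.

Lemma bint_prod1 F : bounded_on (A `*` B) F ->
  \int[(m1 \x m2)%E]_z F z = \int[m1]_x \int[m2]_y F (x, y).
Proof.
move=> bF; have iF : (m1 \x m2)%E.-integrable setT (EFin \o F).
  by apply: (@bounded_on_integrable _ _ _ _ (A `*` B)); rewrite ?setX_lty//;
    exact: measurableX.
rewrite {1}/Rintegral -(integral12_prod_meas1 iF) /Rintegral; congr fine.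
apply: eq_integral => x _; rewrite /fubini_F/= fineK//.
by apply: (@bounded_on_fin_num _ _ _ _ B) => //; exact: bounded_on_slice1.
Qed.

Lemma bint_prod2 F : bounded_on (A `*` B) F ->
  \int[(m1 \x m2)%E]_z F z = \int[m2]_y \int[m1]_x F (x, y).
Proof.
move=> bF; have iF : (m1 \x m2)%E.-integrable setT (EFin \o F).
  by apply: (@bounded_on_integrable _ _ _ _ (A `*` B)); rewrite ?setX_lty//;
    exact: measurableX.
rewrite {1}/Rintegral -(integral21_prod_meas1 iF) /Rintegral; congr fine.
apply: eq_integral => y _; rewrite /fubini_G/= fineK//.
by apply: (@bounded_on_fin_num _ _ _ _ A) => //; exact: bounded_on_slice2.
Qed.

End bounded_on_product.

(** * Entropy on a product of two spaces *)

(** The lower bound on Q makes the logarithms of f and of its marginals bounded. *)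
Definition pinched_on {d} {T : measurableType d} {R : realType}
    (Q : set T) (f : T -> R) :=
  [/\ measurable_fun setT f, (forall x, ~ Q x -> f x = 0) &
      exists lo hi, 0 < lo /\ forall x, Q x -> lo <= f x <= hi].

(** The difference of logarithms, instead of ln (f x / int f), is additive in the
    two places where the proof splits it. *)
Definition entropy {d} {T : measurableType d} {R : realType}
    (m : {measure set T -> \bar R}) (f : T -> R) : R :=
  \int[m]_x (f x * (ln (f x) - ln (\int[m]_z f z))).

(** This is ln t <= t - 1 at t = b / a.  It is the only convexity property of the
    entropy used below: it yields subadditivity over products, the duality with
    exponential moments and the lower bounds on u ln u. *)
Lemma log_sum_pointwise {R : realType} (a b : R) : 0 < a -> 0 < b ->
  a - b <= a * (ln a - ln b).
Proof.
move=> a0 b0; have ba0 : 0 < b / a by rewrite divr_gt0.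
have : ln (1 + (b / a - 1)) <= b / a - 1 by apply: le_ln1Dx; rewrite ltrBrDl subrr.
rewrite subrKC ln_div ?posrE// => h.
rewrite -(ler_pM2l a0) !mulrBr mulrCA divff ?gt_eqF// in h.
rewrite mulrBr; lra.
Qed.

Lemma norm_ln_le {R : realType} (lo hi a : R) : 0 < lo -> lo <= a <= hi ->
  `|ln a| <= `|ln lo| + `|ln hi|.
Proof.
move=> lo0 /andP[la ah]; have a0 := lt_le_trans lo0 la.
have h0 := lt_le_trans a0 ah.
have : ln lo <= ln a by rewrite ler_ln ?posrE.
have : ln a <= ln hi by rewrite ler_ln ?posrE.
rewrite ler_norml => h1 h2.
have := ler_norm (ln hi); have := ler_norm (- ln lo); rewrite normrN => h3 h4.
have h5 := normr_ge0 (ln lo); have h6 := normr_ge0 (ln hi).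
by apply/andP; split; lra.
Qed.

Section pinched.
Context {d} {T : measurableType d} {R : realType}.
Variables (m : {measure set T -> \bar R}) (Q : set T).
Hypotheses (mQ : measurable Q) (Qfin : (m Q < +oo)%E).
Implicit Types f g : T -> R.

Lemma pinched_bounded f : pinched_on Q f -> bounded_on Q f.
Proof.
move=> [mf f0 [lo [hi [lo0 lohi]]]]; split => //; exists hi => x.
have [Qx|nQx] := pselect (Q x).
  have /andP[lf fh] := lohi x Qx.
  by rewrite indicE mem_set// mulr1 ger0_norm// (le_trans (ltW lo0)).
by rewrite f0// normr0 indicE memNset// mulr0.
Qed.

Lemma pinched_gt0 f x : pinched_on Q f -> Q x -> 0 < f x.
Proof.
by move=> [_ _ [lo [hi [lo0 lohi]]]] /lohi/andP[+ _]; exact: lt_le_trans.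
Qed.

Lemma pinched_ln_bound f : pinched_on Q f ->
  exists K, forall x, Q x -> `|ln (f x)| <= K.
Proof.
move=> [_ _ [lo [hi [lo0 lohi]]]]; exists (`|ln lo| + `|ln hi|) => x Qx.
by apply: norm_ln_le => //; exact: lohi.
Qed.

Lemma bounded_on_ln_ratio f g : pinched_on Q f -> measurable_fun setT g ->
  (exists K, forall x, Q x -> `|ln (g x)| <= K) ->
  bounded_on Q (fun x => f x * (ln (f x) - ln (g x))).
Proof.
move=> pf mg [K gK]; have [J fJ] := pinched_ln_bound pf.
apply: (@bounded_onM _ _ _ Q _ _ (J + K)); first exact: pinched_bounded.
  apply: measurable_funB; last exact: measurable_ln_comp.
  by apply: measurable_ln_comp; case: pf.
by move=> x Qx; rewrite (le_trans (ler_normB _ _))// lerD ?fJ ?gK.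
Qed.

Lemma pinched_int_bounds f lo hi : bounded_on Q f ->
  (forall x, Q x -> lo <= f x <= hi) ->
  lo * fine (m Q) <= \int[m]_x f x <= hi * fine (m Q).
Proof.
move=> bf lohi; rewrite -!(bint_indic m mQ) -!(@bintZ _ _ _ m Q)//; last 2 first.
- exact: bounded_on_indic1.
- exact: bounded_on_indic1.
have b k : bounded_on Q (fun x => k * \1_Q x : R).
  by apply: bounded_onZ; exact: bounded_on_indic1.
apply/andP; split; apply: (@bint_le _ _ _ m Q) => // x;
  have [Qx|nQx] := pselect (Q x).
- by rewrite indicE mem_set// mulr1; have /andP[] := lohi x Qx.
- by rewrite (bounded_on_out bf nQx) indicE memNset// mulr0.
- by rewrite indicE mem_set// mulr1; have /andP[] := lohi x Qx.
- by rewrite (bounded_on_out bf nQx) indicE memNset// mulr0.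
Qed.

Lemma pinched_int_gt0 f : (0 < m Q)%E -> pinched_on Q f -> 0 < \int[m]_x f x.
Proof.
move=> Q0 pf; have [mf f0 [lo [hi [lo0 lohi]]]] := pf.
have /andP[h _] := pinched_int_bounds (pinched_bounded pf) lohi.
by rewrite (lt_le_trans _ h)// mulr_gt0// fine_gt0// Q0.
Qed.

End pinched.

Section entropy_product.
Context {d1 d2} {T1 : measurableType d1} {T2 : measurableType d2} {R : realType}.
Variables (m1 : {sigma_finite_measure set T1 -> \bar R}).
Variables (m2 : {sigma_finite_measure set T2 -> \bar R}).
Variables (A : set T1) (B : set T2).
Hypotheses (mA : measurable A) (mB : measurable B).
Hypotheses (Afin : (m1 A < +oo)%E) (Bfin : (m2 B < +oo)%E).
Hypotheses (A_gt0 : (0 < m1 A)%E) (B_gt0 : (0 < m2 B)%E).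
Variable rho : T1 * T2 -> R.
Hypothesis prho : pinched_on (A `*` B) rho.

Let mAB : measurable (A `*` B). Proof. exact: measurableX. Qed.
Let brho := pinched_bounded prho.

Lemma pinched_slice1 x : A x -> pinched_on B (fun y => rho (x, y)).
Proof.
case: prho => mr r0 [lo [hi [lo0 lohi]]] Ax; split.
- exact: measurableT_comp.
- by move=> y nBy; apply: r0 => -[].
- by exists lo, hi; split => // y By; exact: lohi.
Qed.

Lemma pinched_marginal1 : pinched_on A (fun x => \int[m2]_y rho (x, y)).
Proof.
case: prho => mr r0 [lo [hi [lo0 lohi]]].
have b1 := bounded_on_marginal1 mA mB Afin Bfin brho.
split; first exact: b1.1.
  by move=> x nAx; exact: (bounded_on_out b1).
exists (lo * fine (m2 B)), (hi * fine (m2 B)); split.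
  by rewrite mulr_gt0// fine_gt0// B_gt0.
move=> x Ax; apply: pinched_int_bounds => //.
- exact: bounded_on_slice1 brho.
- by move=> y By; exact: lohi.
Qed.

Lemma pinched_marginal2 : pinched_on B (fun y => \int[m1]_x rho (x, y)).
Proof.
case: prho => mr r0 [lo [hi [lo0 lohi]]].
have b2 := bounded_on_marginal2 mA mB Afin Bfin brho.
split; first exact: b2.1.
  by move=> y nBy; exact: (bounded_on_out b2).
exists (lo * fine (m1 A)), (hi * fine (m1 A)); split.
  by rewrite mulr_gt0// fine_gt0// A_gt0.
move=> y By; apply: pinched_int_bounds => //.
- exact: bounded_on_slice2 brho.
- by move=> x Ax; exact: lohi.
Qed.

(** With r1 and s the two marginals of rho, the chain rule writes the entropy as
    that of the slices in the second variable plus that of r1.  Convexity bounds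
    the entropy of r1 by the integrated entropy of the slices in the first
    variable; pointwise this is [log_sum_pointwise] for rho against the density
    s * r1 / Z, which has the same mass Z as rho. *)
Lemma entropy_le_product H0 H1 : bounded_on (A `*` B) H0 ->
  bounded_on (A `*` B) H1 ->
  (forall y, B y -> entropy m1 (fun x => rho (x, y)) <= \int[m1]_x H0 (x, y)) ->
  (forall x, A x -> entropy m2 (fun y => rho (x, y)) <= \int[m2]_y H1 (x, y)) ->
  entropy (m1 \x m2)%E rho <=
    \int[(m1 \x m2)%E]_z H0 z + \int[(m1 \x m2)%E]_z H1 z.
Proof.
move=> bH0 bH1 lineA lineB.
have ABfin := setX_lty mA mB Afin Bfin.
pose r1 x := \int[m2]_y rho (x, y); pose s y := \int[m1]_x rho (x, y).
pose Z := \int[(m1 \x m2)%E]_z rho z.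
have pr1 : pinched_on A r1 by exact: pinched_marginal1.
have ps : pinched_on B s by exact: pinched_marginal2.
have AB0 : (0 < (m1 \x m2) (A `*` B))%E by rewrite product_measure1E// mule_gt0.
have Z0 : 0 < Z by exact: (pinched_int_gt0 mAB ABfin).
have mr1 : measurable_fun setT r1 by case: pr1.
have ms : measurable_fun setT s by case: ps.
pose G1 z := rho z * (ln (rho z) - ln (r1 z.1)).
pose G0 z := rho z * (ln (rho z) - ln (s z.2)).
pose P z := s z.2 * (Z^-1 * r1 z.1).
have bG1 : bounded_on (A `*` B) G1.
  apply: (bounded_on_ln_ratio (g := r1 \o fst)) => //; first exact: measurableT_comp.
  have [K rK] := pinched_ln_bound pr1.
  by exists K => -[x y] [/= Ax _]; exact: rK.
have bG0 : bounded_on (A `*` B) G0.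
  apply: (bounded_on_ln_ratio (g := s \o snd)) => //; first exact: measurableT_comp.
  have [K sK] := pinched_ln_bound ps.
  by exists K => -[x y] [/= _ By]; exact: sK.
have bE : bounded_on (A `*` B) (fun z => rho z * (ln (rho z) - ln Z)).
  by apply: (bounded_on_ln_ratio (g := cst Z)) => //; exists `|ln Z|.
have bs := pinched_bounded ps; have br1 := pinched_bounded pr1.
have bP : bounded_on (A `*` B) P.
  split.
    apply: measurable_funM; first exact: measurableT_comp.
    by apply: measurable_funM => //; exact: measurableT_comp.
  have [M sM] := bs.2; have [N rN] := br1.2.
  exists (M * (`|Z^-1| * N)) => -[x y]; rewrite /P/= 2!normrM.
  have -> : \1_(A `*` B) (x, y) = \1_A x * \1_B y :> R.
    by rewrite !indicE in_setX/= -natrM mulnb.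
  rewrite [leRHS](_ : _ = (M * \1_B y) * (`|Z^-1| * (N * \1_A x))); last by ring.
  by rewrite ler_pM// ?mulr_ge0// ler_wpM2l.
have IP : \int[(m1 \x m2)%E]_z P z = Z.
  rewrite (bint_prod1 mA mB Afin Bfin bP).
  under eq_Rintegral do rewrite /P/=.
  transitivity (\int[m1]_x (r1 x)); last by rewrite /Z (bint_prod1 mA mB Afin Bfin brho).
  apply: eq_Rintegral => x _.
  under eq_Rintegral do rewrite mulrC.
  rewrite (@bintZ _ _ _ m2 B)// -(bint_prod2 mA mB Afin Bfin brho) -/Z.
  by rewrite mulrAC mulVf ?mul1r// gt_eqF.
have I1 : \int[(m1 \x m2)%E]_z G1 z <= \int[(m1 \x m2)%E]_z H1 z.
  rewrite (bint_prod1 mA mB Afin Bfin bG1) (bint_prod1 mA mB Afin Bfin bH1).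
  apply: (@bint_le _ _ _ m1 A) => //; [exact: (bounded_on_marginal1 mA mB Afin Bfin bG1)|exact: (bounded_on_marginal1 mA mB Afin Bfin bH1)|].
  move=> x; have [Ax|nAx] := pselect (A x); first exact: lineB.
  by rewrite (bounded_on_out (bounded_on_marginal1 mA mB Afin Bfin bG1) nAx)
             (bounded_on_out (bounded_on_marginal1 mA mB Afin Bfin bH1) nAx).
have I0 : \int[(m1 \x m2)%E]_z G0 z <= \int[(m1 \x m2)%E]_z H0 z.
  rewrite (bint_prod2 mA mB Afin Bfin bG0) (bint_prod2 mA mB Afin Bfin bH0).
  apply: (@bint_le _ _ _ m2 B) => //; [exact: (bounded_on_marginal2 mA mB Afin Bfin bG0)|exact: (bounded_on_marginal2 mA mB Afin Bfin bH0)|].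
  move=> y; have [By|nBy] := pselect (B y); first exact: lineA.
  by rewrite (bounded_on_out (bounded_on_marginal2 mA mB Afin Bfin bG0) nBy)
             (bounded_on_out (bounded_on_marginal2 mA mB Afin Bfin bH0) nBy).
have bR : bounded_on (A `*` B) (fun z => (G1 z + G0 z) - (rho z - P z)).
  by apply: bounded_onB; [exact: bounded_onD|exact: bounded_onB].
have : entropy (m1 \x m2)%E rho <=
    \int[(m1 \x m2)%E]_z ((G1 z + G0 z) - (rho z - P z)).
  apply: (@bint_le _ _ _ _ (A `*` B)) => //.
  move=> [x y]; have [[/= Ax By]|nAB] := pselect ((A `*` B) (x, y)); last first.
    rewrite (bounded_on_out bE nAB) (bounded_on_out bG1 nAB).
    by rewrite (bounded_on_out bG0 nAB) (bounded_on_out brho nAB)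
               (bounded_on_out bP nAB) addr0 subrr subr0.
  have r0 : 0 < rho (x, y) by apply: (pinched_gt0 prho).
  have r10 : 0 < r1 x by exact: (pinched_gt0 pr1).
  have s0 : 0 < s y by exact: (pinched_gt0 ps).
  have P0 : 0 < P (x, y) by rewrite !mulr_gt0// invr_gt0.
  have := log_sum_pointwise r0 P0.
  rewrite /G1 /G0/= {2}/P/= -/Z lnM ?posrE ?mulr_gt0 ?invr_gt0//.
  by rewrite lnM ?posrE ?invr_gt0// lnV ?posrE//; lra.
move=> /le_trans; apply.
rewrite (@bintB _ _ _ _ (A `*` B))//; last 2 first.
- exact: bounded_onD.
- exact: bounded_onB.
rewrite (@bintB _ _ _ _ (A `*` B))// IP -/Z subrr subr0.
by rewrite (@bintD _ _ _ _ (A `*` B))// addrC lerD.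
Qed.

End entropy_product.

(** * Subadditivity of entropy over the coordinates *)

Definition cube {R : realType} n (a b : R) : set 'rV[R]_n :=
  [set x | forall i, a <= x ord0 i <= b].

(** The line through x in direction i, parametrized by the i-th coordinate. *)
Definition set_coord {R : realType} n (x : 'rV[R]_n) (i : 'I_n) (s : R) : 'rV[R]_n :=
  \row_j (if j == i then s else x ord0 j).

Section cube.
Context {R : realType}.
Implicit Types a b : R.

Let seg a b : set (measurableTypeR R) := `[a, b]%classic.

Let lebesgue_seg_lty a b : (lebesgue_measure (seg a b) < +oo)%E.
Proof.
by rewrite lebesgue_measure_itv/=; case: ifPn; rewrite ?ltry// -EFinD ltry.
Qed.

Lemma measurable_cube n a b : measurable (cube a b : set 'rV[R]_n).
Proof.
rewrite (_ : cube a b = \bigcap_(i in [set: 'I_n])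
    ((fun x : 'rV[R]_n => x ord0 i) @^-1` `[a, b])).
  apply: fin_bigcap_measurable => // i _.
  by rewrite -[X in measurable X]setTI; exact: measurable_coord.
apply/seteqP; split => x /= h i; first by move=> _ /=; rewrite in_itv /= h.
by have := h i I; rewrite /= in_itv.
Qed.

Lemma lebesgue_cube n a b : a <= b ->
  lebesgue_rV n (cube a b) = ((b - a) ^+ n)%:E.
Proof.
move=> ab; transitivity (\prod_(i < n) ((const_mx b : 'rV_n) ord0 i -
    (const_mx a : 'rV_n) ord0 i))%:E; last first.
  by congr EFin; under eq_bigr do rewrite !mxE; rewrite prodr_const card_ord.
rewrite -lebesgue_rV_box => [|i]; last by rewrite !mxE.
congr (lebesgue_rV n _).
by apply/seteqP; split => x /= h i; have := h i; rewrite !mxE.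
Qed.

Lemma cube_cons n a b (p : measurableTypeR R * 'rV[R]_n) :
  cube a b (rV_cons p) <-> (seg a b `*` cube a b) p.
Proof.
split.
  move=> h; split => /=.
    by rewrite /seg/= in_itv/=; have := h ord0; rewrite rV_cons0.
  by move=> i; have := h (lift ord0 i); rewrite rV_consS.
move=> [/=]; rewrite /seg/= in_itv/= => h0 h i.
by case: (unliftP ord0 i) => [j|] ->; rewrite ?rV_consS ?rV_cons0.
Qed.

Lemma rV_unconsK n : cancel (@rV_uncons R n) (@rV_cons R n).
Proof.
move=> x; apply/rowP => i; case: (unliftP ord0 i) => [j|] ->.
  by rewrite rV_consS/= mxE.
by rewrite rV_cons0.
Qed.

Lemma set_coord_cons0 n (s t : R) (y : 'rV[R]_n) :
  set_coord (rV_cons (t, y)) ord0 s = rV_cons (s, y).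
Proof.
apply/rowP => i; rewrite mxE; case: (unliftP ord0 i) => [j|] ->.
  by rewrite !rV_consS.
by rewrite eqxx rV_cons0.
Qed.

Lemma set_coord_consS n (i : 'I_n) (s t : R) (y : 'rV[R]_n) :
  set_coord (rV_cons (t, y)) (lift ord0 i) s = rV_cons (t, set_coord y i s).
Proof.
apply/rowP => k; rewrite mxE; case: (unliftP ord0 k) => [j|] ->.
  by rewrite !rV_consS mxE (inj_eq lift_inj).
by rewrite !rV_cons0.
Qed.

Lemma bounded_on_cons n a b (F : 'rV[R]_n.+1 -> R) : bounded_on (cube a b) F ->
  bounded_on (seg a b `*` cube a b) (F \o @rV_cons R n).
Proof.
move=> [mF [M FM]]; split.
  by apply: measurableT_comp => //; exact: measurable_rV_cons.
exists M => p /=; rewrite (le_trans (FM _))//.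
rewrite (_ : \1_(cube a b) _ = \1_(seg a b `*` cube a b) p :> R)// !indicE.
congr (nat_of_bool _)%:R.
by apply/idP/idP; rewrite !inE => /cube_cons.
Qed.

Lemma bint_cons n a b (F : 'rV[R]_n.+1 -> R) : a <= b -> bounded_on (cube a b) F ->
  \int[lebesgue_rV n.+1]_x F x =
  \int[(@lebesgue_measure R \x lebesgue_rV n)%E]_p F (rV_cons p).
Proof.
move=> ab bF; congr fine.
have := @integral_pushforward _ _ _ _ R _ (@measurable_rV_cons R n)
  (@lebesgue_measure R \x lebesgue_rV n)%E setT (EFin \o F) => /= <- //.
- by apply/measurable_EFinP; case: bF.
- rewrite preimage_setT; apply: (bounded_on_integrable _ _ (bounded_on_cons bF)).
  + by apply: measurableX; [exact: measurable_itv|exact: measurable_cube].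
  + apply: setX_lty.
    * exact: measurable_itv.
    * exact: measurable_cube.
    * exact: lebesgue_seg_lty.
    * by rewrite lebesgue_cube// ltry.
Qed.

(** Peeling off one coordinate at a time with [entropy_le_product]: the slices in
    the first coordinate are lines, the others are handled by induction. *)
Theorem entropy_le_sum_lines n a b (rho : 'rV[R]_n -> R) (H : 'I_n -> 'rV[R]_n -> R) :
  a < b -> pinched_on (cube a b) rho -> (forall i, bounded_on (cube a b) (H i)) ->
  (forall i x, cube a b x ->
     entropy lebesgue_measure (fun s => rho (set_coord x i s)) <=
     \int[lebesgue_measure]_s H i (set_coord x i s)) ->
  entropy (lebesgue_rV n) rho <= \sum_(i < n) \int[lebesgue_rV n]_x H i x.
Proof.
move=> ab; elim: n rho H => [|n IH] rho H prho bH line.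
  rewrite big_ord0 /entropy.
  have dE (F : 'rV[R]_0 -> R) : measurable_fun setT F ->
      \int[lebesgue_rV 0]_x F x = F 0.
    move=> mF; rewrite /Rintegral/= integral_dirac//; last exact/measurable_EFinP.
    by rewrite diracT mul1e.
  have mrho : measurable_fun setT rho by case: prho.
  rewrite dE; last first.
    apply: measurable_funM => //; apply: measurable_funB => //.
    exact: measurable_ln_comp.
  by rewrite dE// subrr mulr0.
have abfin := lebesgue_seg_lty a b.
have ab0 : (0 < lebesgue_measure (seg a b))%E.
  by rewrite lebesgue_measure_itv/= lte_fin ab -EFinD lte_fin subr_gt0.
have mC := measurable_cube (n := n) a b.
have Cfin : (lebesgue_rV n (cube a b) < +oo)%E by rewrite lebesgue_cube ?ltry// ltW.
have C0 : (0 < lebesgue_rV n (cube a b))%E.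
  by rewrite lebesgue_cube ?ltW// lte_fin exprn_gt0// subr_gt0.
pose A := seg a b.
have mA : measurable A by exact: measurable_itv.
pose rho' := rho \o @rV_cons R n.
have prho' : pinched_on (A `*` cube a b) rho'.
  case: prho => mr r0 [lo [hi [lo0 lohi]]]; split.
  - by apply: measurableT_comp => //; exact: measurable_rV_cons.
  - by move=> p nQ; apply: r0 => /cube_cons.
  - by exists lo, hi; split => // p Qp; apply: lohi; exact/cube_cons.
have brho := pinched_bounded prho; have brho' := pinched_bounded prho'.
have bH' i : bounded_on (A `*` cube a b) (H i \o @rV_cons R n) by exact: bounded_on_cons.
rewrite big_ord_recl.
have -> : entropy (lebesgue_rV n.+1) rho =
    entropy (@lebesgue_measure R \x lebesgue_rV n)%E rho'.
  rewrite /entropy -(bint_cons (ltW ab) brho).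
  rewrite (@bint_cons n a b) ?ltW//.
  apply: (bounded_on_ln_ratio (g := cst (\int[lebesgue_rV n.+1]_z rho z))) => //.
  by exists `|ln (\int[lebesgue_rV n.+1]_z rho z)|.
pose H1 p := \sum_(i < n) H (lift ord0 i) (rV_cons p).
have bH1 : bounded_on (A `*` cube a b) H1.
  exact: (bounded_on_sum _ (fun i => bH' (lift ord0 i))).
have mX : measurable (A `*` (cube a b : set 'rV[R]_n)).
  exact: measurableX.
have Xfin := setX_lty mA mC abfin Cfin.
have -> : \sum_(i < n) \int[lebesgue_rV n.+1]_x H (lift ord0 i) x =
    \int[(@lebesgue_measure R \x lebesgue_rV n)%E]_p H1 p.
  rewrite (bint_sum mX Xfin); last by move=> i; exact: (bH' (lift ord0 i)).
  by apply: eq_bigr => i _; rewrite (bint_cons (ltW ab)).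
rewrite (bint_cons (ltW ab) (bH ord0)).
apply: (@entropy_le_product _ _ (measurableTypeR R) _ R lebesgue_measure
  (lebesgue_rV n) A (cube a b) mA mC abfin Cfin ab0 C0 rho' prho'
  (H ord0 \o @rV_cons R n) H1 (bH' ord0) bH1).
- move=> y Cy.
  have Qy : cube a b (rV_cons (a, y)).
    by apply/cube_cons; split => //=; rewrite /A /seg/= in_itv/= lexx ltW.
  have := line ord0 _ Qy.
  by under eq_fun do rewrite set_coord_cons0; under eq_Rintegral do rewrite set_coord_cons0.
- move=> x Ax.
  have := IH (fun y => rho (rV_cons (x, y))) (fun i y => H (lift ord0 i) (rV_cons (x, y))).
  rewrite -(bint_sum mC Cfin); last first.
    by move=> i; exact: (bounded_on_slice1 x (bH' (lift ord0 i))).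
  apply.
  + exact: (pinched_slice1 prho').
  + by move=> i; exact: (bounded_on_slice1 x (bH' (lift ord0 i))).
  + move=> i y Cy.
    have Qy : cube a b (rV_cons (x, y)) by exact/cube_cons.
    have := line (lift ord0 i) _ Qy.
    by under eq_fun do rewrite set_coord_consS;
       under eq_Rintegral do rewrite set_coord_consS.
Qed.

End cube.

(** * The fundamental theorem for bounded, possibly discontinuous derivatives *)

Section one_dimension.
Context {R : realType}.
Notation leb := (@lebesgue_measure R).

Lemma is_derive_cvg_seq (f : R -> R) (x df : R) (h : nat -> R) :
  is_derive x 1 f df -> (forall n, h n != 0) -> h @ \oo --> (0 : R) ->
  (fun n => (h n)^-1 * (f (x + h n) - f x)) @ \oo --> df.
Proof.
move=> [dv <-] h0 hcvg.
have dvc : t^-1 * (f (x + t) - f x) @[t --> (0 : R)^'] --> 'D_1 f x.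
  have := dv; rewrite /derivable => /cvgP.
  have -> : (fun t : R => t^-1 * (f (x + t) - f x)) =
            (fun t : R => t^-1 *: (f (t *: (1 : R) + x) - f x)).
    by apply/funext => t; rewrite /GRing.scale/= mulr1 (addrC t).
  by move=> _; exact: dv.
by have /cvgr_dnbhsP := dvc; apply; split.
Qed.

Lemma is_derive_continuous (f : R -> R) (x df : R) :
  is_derive x 1 f df -> {for x, continuous f}.
Proof.
by move=> [dv _]; apply: differentiable_continuous; exact/derivable1_diffP.
Qed.

(** The derivative of V need not be continuous.  The difference quotients of psi
    are continuous and bounded by K through the mean value theorem, so dominated
    convergence transfers the formula from them; their primitives are difference
    quotients of a primitive of psi. *)
Lemma FTC2_bounded_derivative (psi psi' : R -> R) (a' a b b' K : R) :
  a' < a -> a < b -> b < b' ->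
  (forall s, a' < s < b' -> is_derive s 1 psi (psi' s)) ->
  (forall s, a' < s < b' -> `|psi' s| <= K) ->
  (\int[leb]_(s in `[a, b]) (psi' s)%:E)%E = (psi b - psi a)%:E.
Proof.
move=> a'a ab bb' dpsi psi'K.
(* room to shift by h n without leaving the interval where psi is differentiable *)
pose a1 := (a' + a) / 2; pose b1 := (b + b') / 2.
have a'a1 : a' < a1 by rewrite /a1; lra.
have a1a : a1 < a by rewrite /a1; lra.
have bb1 : b < b1 by rewrite /b1; lra.
have b1b' : b1 < b' by rewrite /b1; lra.
have cpsi s : a' < s < b' -> {for s, continuous psi}.
  by move=> sab; exact: is_derive_continuous (dpsi _ sab).
pose Psi s := \int[leb]_(t in `[a1, s]) psi t.
have ipsi : leb.-integrable `[a1, b1] (EFin \o psi).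
  apply: continuous_compact_integrable; first exact: segment_compact.
  apply: continuous_in_subspaceT => s; rewrite inE/= in_itv/= => /andP[h1 h2].
  by apply: cpsi; rewrite (lt_le_trans a'a1)//= (le_lt_trans h2).
have dPsi s : a1 < s < b1 -> is_derive s 1 Psi (psi s).
  move=> /andP[h1 h2].
  have [|dv dE] := continuous_FTC1_closed h2 ipsi h1.
    by apply: cpsi; rewrite (lt_trans a'a1)//= (lt_trans h2).
  by apply: DeriveDef; [exact: dv|rewrite -derive1E; exact: dE].
pose h n := (b1 - b) / 2 * n.+1%:R^-1 : R.
have h_gt0 n : 0 < h n by rewrite !mulr_gt0 ?subr_gt0// ?invr_gt0 ?ltr0n.
have h_lt n : h n < b1 - b.
  have : h n <= (b1 - b) / 2.
    apply: ler_piMr; first by rewrite divr_ge0 ?subr_ge0 ?(ltW bb1).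
    by rewrite invf_le1 ?ler1n ?ltr0n.
  by lra.
have h_cvg : h @ \oo --> (0 : R).
  rewrite -[X in _ --> X](mulr0 ((b1 - b) / 2)).
  by apply: cvgMl_tmp; exact: cvg_harmonic.
have h_neq0 n : h n != 0 by rewrite gt_eqF.
pose D n s := (h n)^-1 * (psi (s + h n) - psi s).
pose G n s := (h n)^-1 * (Psi (s + h n) - Psi s).
have shift_in n s : a <= s <= b -> a1 < s + h n < b1.
  by move=> /andP[h1 h2]; have := h_gt0 n; have := h_lt n; move=> ? ?;
    apply/andP; split; lra.
have cD n s : a <= s <= b -> {for s, continuous (D n)}.
  move=> sab; have /andP[s1 s2] := shift_in n s sab; have /andP[as_ sb] := sab.
  apply: cvgMl_tmp.
  apply: cvgB; last by apply: cpsi; apply/andP; split; lra.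
  apply: (@cvg_comp _ _ _ (fun s => s + h n) psi _ (nbhs (s + h n))).
    by apply: cvgD; [exact: cvg_id|exact: cvg_cst].
  by apply: cpsi; apply/andP; split; lra.
have DcvgE : (\int[leb]_(s in `[a, b]) (D n s)%:E)%E @[n --> \oo] -->
    (\int[leb]_(s in `[a, b]) (psi' s)%:E)%E.
  apply: (@dominated_cvg _ _ _ leb `[a, b] _ (fun n s => (D n s)%:E)
            (fun s => (psi' s)%:E) (fun=> K%:E)) => //.
  - move=> n; apply/measurable_EFinP.
    apply: subspace_continuous_measurable_fun => //.
    apply: continuous_in_subspaceT => s; rewrite inE/= in_itv/= => sab.
    exact: cD.
  - move=> s /=; rewrite in_itv/= => /andP[h1 h2].
    apply: cvg_EFin; first by apply: nearW.
    by apply: is_derive_cvg_seq => //; apply: dpsi; apply/andP; split; lra.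
  - apply/integrableP; split; first exact: measurable_cst.
    rewrite integral_cst//= lebesgue_measure_itv/= lte_fin ab.
    by rewrite -EFinD -EFinM ltry.
  - move=> n s /=; rewrite in_itv/= => sab; rewrite lee_fin.
    have /andP[s1 s2] := shift_in n s sab; have /andP[as_ sb] := sab.
    have [|||c] := @MVT _ psi psi' s (s + h n).
    + by rewrite ltrDl.
    + move=> t; rewrite in_itv/= => /andP[t1 t2]; apply: dpsi.
      by apply/andP; split; lra.
    + apply: continuous_in_subspaceT => t; rewrite inE/= in_itv/= => /andP[t1 t2].
      by apply: cpsi; apply/andP; split; lra.
    rewrite in_itv/= => /andP[c1 c2]; rewrite /D => ->.
    rewrite addrAC subrr add0r mulrCA mulVf// mulr1.
    by apply: psi'K; apply/andP; split; lra.
have dG n s : a <= s <= b -> is_derive s 1 (G n) (D n s).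
  move=> sab; have /andP[s1 s2] := shift_in n s sab; have /andP[as_ sb] := sab.
  have d1 : is_derive s 1 Psi (psi s) by apply: dPsi; apply/andP; split; lra.
  have d2 : is_derive (s + h n) 1 Psi (psi (s + h n)).
    by apply: dPsi; apply/andP; split; lra.
  have d3 : is_derive s 1 (Psi \o (fun u => u + h n)) (psi (s + h n) * 1).
    by apply: is_derive1_comp; exact: is_derive_shift.
  have d4 := is_deriveZ (h n)^-1 (is_deriveB d3 d1).
  by rewrite mulr1 in d4.
have DE n : (\int[leb]_(s in `[a, b]) (D n s)%:E)%E = (G n b - G n a)%:E.
  rewrite (@continuous_FTC2 _ (D n) (G n) _ _ ab)//.
  - apply: continuous_in_subspaceT => s; rewrite inE/= in_itv/= => sab.
    exact: cD.
  - split.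
    + by move=> s; rewrite in_itv/= => /andP[s1 s2]; have [] := dG n s _;
        first by rewrite (ltW s1) (ltW s2).
    + apply: cvg_at_right_filter; apply: (is_derive_continuous (df := D n a)).
      by apply: dG; rewrite lexx (ltW ab).
    + apply: cvg_at_left_filter; apply: (is_derive_continuous (df := D n b)).
      by apply: dG; rewrite lexx (ltW ab).
  - move=> s; rewrite in_itv/= => /andP[s1 s2]; rewrite derive1E.
    have dGs : is_derive s 1 (G n) (D n s) by apply: dG; rewrite (ltW s1) (ltW s2).
    by case: dGs.
have Gcvg c : a <= c <= b -> (fun n => G n c) @ \oo --> psi c.
  move=> /andP[ac cb]; apply: is_derive_cvg_seq => //.
  by apply: dPsi; apply/andP; split; lra.
apply/esym/(cvg_unique _ _ DcvgE) => //.
rewrite (_ : (fun n => _) = (fun n => (G n b - G n a)%:E)); last exact/funext.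
apply: cvg_EFin; first by apply: nearW.
by apply: cvgB; apply: Gcvg; rewrite lexx (ltW ab).
Qed.
End one_dimension.

(** * The entropy inequality on a line *)

Lemma compact_continuous_bounded {R : realType} {T : topologicalType}
    (A : set T) (f : T -> R) :
  compact A -> {within A, continuous f} ->
  exists M, forall x, A x -> `|f x| <= M.
Proof.
move=> cA cf.
have [M [_ Mf]] := compact_bounded (continuous_compact cf cA).
by exists (M + 1) => x Ax; apply: (Mf (M + 1)); [rewrite ltrDl|exists x].
Qed.

Lemma bint_indicM {d} {T : measurableType d} {R : realType}
    (m : {measure set T -> \bar R}) (Q : set T) (f : T -> R) :
  \int[m]_x (\1_Q x * f x) = \int[m]_(x in Q) f x.
Proof.
rewrite [RHS]Rintegral_mkcond; apply: eq_Rintegral => x _.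
by rewrite patchE indicE; case: ifPn => _; rewrite ?mul1r ?mul0r.
Qed.

Section line_entropy.
Context {R : realType}.
Notation leb := (@lebesgue_measure R).

Lemma bounded_on_continuous (a b : R) (f : R -> R) :
  {within `[a, b], continuous f} ->
  bounded_on (`[a, b]%classic : set (measurableTypeR R))
    (fun s : measurableTypeR R => \1_`[a, b] s * f s).
Proof.
move=> cf; have [M fM] := compact_continuous_bounded (@segment_compact _ a b) cf.
have mf : measurable_fun `[a, b] f by exact: subspace_continuous_measurable_fun.
split.
  rewrite (_ : (fun _ => _) = f \_ `[a, b]); last first.
    apply/funext => x; rewrite patchE indicE.
    by case: ifPn => _; rewrite ?mul1r ?mul0r.
  by apply/(measurable_restrictT f) => //; exact: measurable_itv.
exists M => x; rewrite normrM mulrC [X in _ * X]ger0_norm// indicE.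
have [xab|] := boolP (x \in `[a, b]%classic); last by rewrite !mulr0.
by rewrite ler_wpM2r//; apply: fM; rewrite inE in xab.
Qed.

(** One-dimensional transport: T pushes the density g restricted to [a, b] onto
    the uniform measure on [p, q].  The two boundary terms g b * (q - b) and
    - g a * (p - a) of the integration by parts are nonpositive because
    a <= p and q <= b. *)
Lemma entropy_le_line (g g' : R -> R) (a b p q K : R) :
  a <= p -> p < q -> q <= b ->
  measurable_fun setT g' ->
  (forall s : R, is_derive s 1 g (g' s)) -> (forall s, 0 < g s) ->
  (forall s, a - 1 <= s <= b + 1 -> `|g' s| <= K) ->
  entropy leb (fun s => \1_`[a, b] s * g s) <=
  \int[leb]_s (\1_`[a, b] s *
    (Num.max ((s - p) * g' s) ((s - q) * g' s) - ln (q - p) * g s)).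
Proof.
move=> ap pq qb mg' dg g_gt0 g'K.
have ab : a < b by lra.
pose S : set (measurableTypeR R) := `[a, b]%classic.
have mS : measurable S by exact: measurable_itv.
have Sfin : (leb S < +oo)%E.
  by rewrite /S lebesgue_measure_itv/= lte_fin ab -EFinD ltry.
have S_gt0 : (0 < leb S)%E.
  by rewrite /S lebesgue_measure_itv/= lte_fin ab -EFinD lte_fin subr_gt0.
have cg : continuous g by move=> s; exact: is_derive_continuous (dg s).
(* the lower limit a - 1 makes P differentiable at a as well *)
pose P s := \int[leb]_(t in `[a - 1, s]) g t.
have ig : leb.-integrable `[a - 1, b + 1] (EFin \o g).
  apply: continuous_compact_integrable; first exact: segment_compact.
  exact: continuous_subspaceT.
have dP s : a - 1 < s < b + 1 -> is_derive s 1 P (g s).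
  move=> /andP[h1 h2].
  have [|dv dE] := continuous_FTC1_closed h2 ig h1; first exact: cg.
  by apply: DeriveDef; [exact: dv|rewrite -derive1E; exact: dE].
have P_nd s t : a <= s -> s <= t -> t <= b -> P s <= P t.
  move=> as_ st tb; have [||c _] := @MVT_segment _ P g s t st.
  - move=> x; rewrite in_itv/= => /andP[x1 x2].
    by apply: dP; apply/andP; split; lra.
  - apply: continuous_in_subspaceT => x; rewrite inE/= in_itv/= => /andP[x1 x2].
    by apply: (is_derive_continuous (df := g x)); apply: dP; apply/andP; split; lra.
  - by move=> e; rewrite -subr_ge0 e mulr_ge0 ?subr_ge0// ltW.
have [M gM] := compact_continuous_bounded (@segment_compact _ (a - 1) (b + 1))
  (continuous_subspaceT cg).
pose Z := P b - P a.
have ZE : \int[leb]_s (\1_`[a, b] s * g s) = Z.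
  rewrite bint_indicM /Rintegral.
  rewrite (@FTC2_bounded_derivative _ P g (a - 1) a b (b + 1) M)//; try lra.
  by move=> s /andP[s1 s2]; apply: gM; rewrite /= in_itv/= !ltW.
have [lo [lo0 log]] : exists lo, 0 < lo /\ forall s, a <= s <= b -> lo <= g s.
  have [s0 s0ab gs0] := @EVT_min _ g a b (ltW ab) (continuous_subspaceT cg).
  by exists (g s0); split => // s sab; apply: gs0; rewrite in_itv/=.
have prho : pinched_on S (fun s => \1_`[a, b] s * g s).
  have [mf bf] := bounded_on_continuous (continuous_subspaceT cg : {within `[a, b], continuous g}).
  split => //.
  - by move=> s nS; rewrite indicE memNset// mul0r.
  - exists lo, M; split => // s Ss; rewrite indicE mem_set// mul1r.
    move: Ss; rewrite /S/= in_itv/= => sab; rewrite log//=.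
    apply: le_trans (ler_norm _) _; apply: gM.
    by rewrite /= in_itv/=; move/andP : sab => [? ?]; apply/andP; split; lra.
have Z_gt0 : 0 < Z.
  by rewrite -ZE; exact: (pinched_int_gt0 mS Sfin S_gt0 prho).
pose r := (q - p) / Z.
have r_gt0 : 0 < r by rewrite divr_gt0// subr_gt0.
pose T s := p + r * (P s - P a).
(* integrating psi' over [a, b] performs the integration by parts *)
pose psi s := g s * (T s - s).
pose psi' s := g' s * (T s - s) + g s * (r * g s - 1).
have dT s : a - 1 < s < b + 1 -> is_derive s 1 T (r * g s).
  move=> sab; have d1 := dP _ sab.
  have := is_deriveD (is_derive_cst p s 1)
    (is_deriveZ r (is_deriveB d1 (is_derive_cst (P a) s 1))).
  by rewrite subr0 add0r.
have cT s : a - 1 < s < b + 1 -> {for s, continuous T}.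
  by move=> /dT; exact: is_derive_continuous.
have dpsi s : a - 1 < s < b + 1 -> is_derive s 1 psi (psi' s).
  move=> sab.
  have -> : psi' s = g s *: (r * g s - 1) + (T s - s) *: g' s.
    by rewrite /psi' /GRing.scale/=; ring.
  exact: is_deriveM (dg s) (is_deriveB (dT _ sab) (is_derive_id s 1)).
have T_pq s : a <= s <= b -> p <= T s <= q.
  move=> /andP[as_ sb]; rewrite /T.
  have h1 := P_nd a s (lexx _) as_ sb; have h2 := P_nd s b as_ sb (lexx _).
  have h3 : 0 <= r * (P s - P a) by rewrite mulr_ge0 ?subr_ge0// ltW.
  have h4 : r * (P s - P a) <= r * Z by rewrite ler_wpM2l ?(ltW r_gt0)// lerB.
  have h5 : r * Z = q - p by rewrite mulfVK// gt_eqF.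
  by apply/andP; split; lra.
pose H s := Num.max ((s - p) * g' s) ((s - q) * g' s) - ln (q - p) * g s.
have bound s : a <= s <= b -> g s * (ln (g s) - ln Z) <= psi' s + H s.
  move=> sab; have /andP[pT Tq] := T_pq s sab.
  have h1 : g s * (ln (g s) - ln Z) + ln (q - p) * g s <= g s * (r * g s - 1).
    rewrite [X in _ + X]mulrC -mulrDr ler_pM2l//.
    have : ln (1 + (r * g s - 1)) <= r * g s - 1.
      by apply: le_ln1Dx; rewrite ltrBrDl subrr mulr_gt0.
    rewrite subrKC lnM ?posrE// {1}/r ln_div ?posrE//; last by rewrite subr_gt0.
    by lra.
  have h2 : - (g' s * (T s - s)) <= Num.max ((s - p) * g' s) ((s - q) * g' s).
    (* the expression is affine in T s, hence largest at p or q *)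
    rewrite le_max; have [g0|g0] := leP 0 (g' s).
      by apply/orP; left; rewrite -mulrN mulrC opprB ler_wpM2r// lerD2l lerN2.
    by apply/orP; right; rewrite -mulrN mulrC opprB ler_wnM2r ?(ltW g0)// lerD2l lerN2.
  rewrite /psi' /H; move: h1 h2; move: (Num.max _ _) => m.
  move: (g s * (ln (g s) - ln Z)) (g s * (r * g s - 1)) => u v.
  move: (g' s * (T s - s)) (ln (q - p) * g s) => w z; lra.
have bmul (f : R -> R) K' : measurable_fun setT f -> (forall s, a <= s <= b -> `|f s| <= K') ->
    bounded_on S (fun s : measurableTypeR R => \1_`[a, b] s * f s).
  move=> mf fK; apply: (bounded_on_indic mS mf (K := K')) => s.
  by rewrite /S/= in_itv/=; exact: fK.
have bg := pinched_bounded prho.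
have bT : bounded_on S (fun s : measurableTypeR R => \1_`[a, b] s * (T s - s)).
  apply: bounded_on_continuous; apply: continuous_in_subspaceT => s.
  rewrite inE/= in_itv/= => /andP[s1 s2].
  apply: cvgB; last exact: cvg_id.
  by apply: cT; apply/andP; split; lra.
have mg : measurable_fun setT g by exact: continuous_measurable_fun.
have g'K' s : S s -> `|g' s| <= K.
  by rewrite /S/= in_itv/= => /andP[s1 s2]; apply: g'K; apply/andP; split; lra.
have gM' s : S s -> `|g s| <= M.
  by rewrite /S/= in_itv/= => /andP[s1 s2]; apply: gM; rewrite /= in_itv/=;
    apply/andP; split; lra.
have bpsi' : bounded_on S (fun s : measurableTypeR R => \1_`[a, b] s * psi' s).
  rewrite (_ : (fun _ => _) = (fun s : measurableTypeR R =>
      \1_`[a, b] s * (T s - s) * g' s +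
      (r * (\1_`[a, b] s * g s) - \1_`[a, b] s) * g s)); last first.
    by apply/funext => s; rewrite /psi'; ring.
  apply: bounded_onD; first exact: bounded_onM bT mg' g'K'.
  apply: (@bounded_onM _ _ _ S _ g M) => //.
  exact: (bounded_onB (bounded_onZ r bg) (bounded_on_indic1 mS)).
have bH : bounded_on S (fun s : measurableTypeR R => \1_`[a, b] s * H s).
  apply: (bmul _ (((b - a) * K + (b - a) * K) + `|ln (q - p)| * M)).
    apply: measurable_funB; last by apply: measurable_funM.
    by apply: measurable_maxr; apply: measurable_funM => //; exact: measurable_funB.
  move=> s sab; have Ss : S s by rewrite /S/= in_itv.
  have /andP[s1 s2] := sab.
  have h u : a <= u <= b -> `|(s - u) * g' s| <= (b - a) * K.
    move=> /andP[u1 u2]; rewrite normrM ler_pM//; last exact: g'K'.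
    by rewrite ler_norml; apply/andP; split; lra.
  have hp : `|(s - p) * g' s| <= (b - a) * K by apply: h; apply/andP; split; lra.
  have hq : `|(s - q) * g' s| <= (b - a) * K by apply: h; apply/andP; split; lra.
  have K0 : 0 <= (b - a) * K by exact: le_trans hp.
  rewrite (le_trans (ler_normB _ _))// lerD//; last by rewrite normrM ler_wpM2l// gM'.
  by rewrite /Num.max; case: ifPn => _; [apply: (le_trans hq)|apply: (le_trans hp)];
    rewrite lerDl.
have bE : bounded_on S (fun s : measurableTypeR R =>
    (\1_`[a, b] s * g s) * (ln (\1_`[a, b] s * g s) - ln Z)).
  by apply: (bounded_on_ln_ratio (g := cst Z) prho) => //; exists `|ln Z|.
rewrite /entropy ZE.
have Ipsi : \int[leb]_s (\1_`[a, b] s * psi' s) <= 0.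
  have cTs : {within `[a - 2^-1, b + 2^-1], continuous (fun s => T s - s)}.
    apply: continuous_in_subspaceT => s; rewrite inE/= in_itv/= => /andP[s1 s2].
    by apply: cvgB; [apply: cT; apply/andP; split; lra|exact: cvg_id].
  have [MT TM] := compact_continuous_bounded
    (@segment_compact _ (a - 2^-1) (b + 2^-1)) cTs.
  rewrite bint_indicM /Rintegral.
  have dpsi2 s : a - 2^-1 < s < b + 2^-1 -> is_derive s 1 psi (psi' s).
    by move=> /andP[s1 s2]; apply: dpsi; apply/andP; split; lra.
  have psi'K s : a - 2^-1 < s < b + 2^-1 -> `|psi' s| <= K * MT + M * (r * M + 1).
    move=> /andP[s1 s2].
    have gMs : `|g s| <= M.
      by apply: gM; rewrite /= in_itv/=; apply/andP; split; lra.
    rewrite (le_trans (ler_normD _ _))// !normrM lerD// ler_pM//.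
    + by apply: g'K; apply/andP; split; lra.
    + by apply: TM; rewrite /= in_itv/=; apply/andP; split; lra.
    + rewrite (le_trans (ler_normB _ _))// normr1 lerD2r normrM.
      by rewrite (gtr0_norm r_gt0) ler_wpM2l// ltW.
  have a'a : a - 2^-1 < a by lra.
  have bb' : b < b + 2^-1 by lra.
  have -> := FTC2_bounded_derivative a'a ab bb' dpsi2 psi'K.
  have Tb : T b = q by rewrite /T -/Z mulfVK ?gt_eqF//; lra.
  have Ta : T a = p by rewrite /T subrr mulr0 addr0.
  rewrite /psi Ta Tb/=.
  have hb : g b * (q - b) <= 0 by rewrite pmulr_rle0//; lra.
  have ha : 0 <= g a * (p - a) by rewrite pmulr_rge0//; lra.
  by lra.
rewrite -[leRHS]add0r.
apply: (@le_trans _ _ (\int[leb]_s (\1_`[a, b] s * psi' s + \1_`[a, b] s * H s))).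
  apply: (bint_le mS Sfin) => //; first exact: bounded_onD.
  move=> s; rewrite indicE; have [|] := boolP (s \in `[a, b]%classic).
    by rewrite inE/= in_itv/= => sab; rewrite !mul1r; exact: bound.
  by rewrite !mul0r addr0.
by rewrite (bintD mS Sfin)// lerD2r.
Qed.
End line_entropy.

(** * Measurability, convexity and partial derivatives on row vectors *)

Section rV_topology.
Context {R : realType}.

Lemma norm_coord_le n (x : 'rV[R]_n) i : `|x ord0 i| <= `|x|.
Proof.
have /mapP[j Hj ->] : `|x ord0 i| \in [seq `|x k.1 k.2| | k : 'I_1 * 'I_n].
  by apply/mapP; exists (ord0, i) => //=; rewrite mem_enum.
by rewrite [leRHS]/Num.norm /= mx_normrE; apply/bigmax_geP; right => /=; exists j.
Qed.

Lemma compact_cube n (a b : R) : compact (cube a b : set 'rV[R]_n).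
Proof.
rewrite (_ : cube a b = [set v : 'rV[R]_n | forall i, `[a, b]%classic (v ord0 i)]).
  by apply: (@rV_compact _ _ (fun=> `[a, b]%classic)) => _; exact: segment_compact.
by apply/seteqP; split => x /= h i; have := h i; rewrite in_itv.
Qed.

Let grid n k (x : 'rV[R]_n) : 'rV[int]_n := \row_i Num.floor (x ord0 i * k.+1%:R).
Let ungrid n k (v : 'rV[int]_n) : 'rV[R]_n := \row_i ((v ord0 i)%:~R / k.+1%:R).

Let measurable_grid n k (v : 'rV[int]_n) : measurable [set x : 'rV[R]_n | grid k x = v].
Proof.
rewrite (_ : mkset _ = \bigcap_(i in [set: 'I_n])
    ((fun x : 'rV[R]_n => x ord0 i * k.+1%:R) @^-1`
      `[(v ord0 i)%:~R, (v ord0 i + 1)%:~R[)).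
  apply: fin_bigcap_measurable => // i _.
  rewrite -[X in measurable X]setTI.
  have : measurable_fun setT (fun x : 'rV[R]_n => x ord0 i * k.+1%:R).
    by apply: measurable_funM => //; exact: measurable_coord.
  by apply => //; exact: measurable_itv.
apply/seteqP; split => x /=.
  by move=> <- i _ /=; rewrite in_itv/= mxE floor_itv.
move=> h; apply/rowP => i; rewrite mxE; apply: floor_def.
by have := h i I; rewrite /= in_itv.
Qed.

Let ungrid_near n k (x : 'rV[R]_n) i j :
  `|x i j - ungrid k (grid k x) i j| <= k.+1%:R^-1.
Proof.
rewrite ord1 !mxE.
have k0 : 0 < k.+1%:R :> R by rewrite ltr0n.
have /andP[h1 h2] := floor_itv (x ord0 j * k.+1%:R).
rewrite intrD mulr1z in h2.
have -> : x ord0 j - (Num.floor (x ord0 j * k.+1%:R))%:~R / k.+1%:R =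
  (x ord0 j * k.+1%:R - (Num.floor (x ord0 j * k.+1%:R))%:~R) * k.+1%:R^-1.
  by rewrite mulrBl mulfK// gt_eqF.
rewrite normrM [X in _ * X]ger0_norm ?invr_ge0 ?(ltW k0)//.
rewrite ler_piMl ?invr_ge0 ?(ltW k0)//.
by rewrite ger0_norm ?subr_ge0// lerBlDl addrC ltW// addrC.
Qed.

(** The sigma-algebra is generated by coordinates, so continuity is exploited
    through approximation: f is the limit of its values at the grid points of
    mesh 1 / (k + 1), and each of these approximations takes countably many
    values on sets cut out by coordinates. *)
Lemma continuous_measurable_rV n (f : 'rV[R]_n -> R) :
  continuous f -> measurable_fun setT f.
Proof.
move=> cf.
apply: (measurable_fun_cvg (h := fun k x => f (ungrid k (grid k x)))).
  move=> k _ Y mY; rewrite setTI.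
  rewrite (_ : _ @^-1` Y = \bigcup_(v : 'rV[int]_n)
      (if pselect (Y (f (ungrid k v))) is left _ then [set x | grid k x = v] else set0)).
    apply: countable_bigcupT_measurable => // v.
    by case: pselect => _ //; exact: measurable_grid.
  apply/seteqP; split => x /=.
    by move=> Yx; exists (grid k x) => //; case: pselect.
  by move=> [v _]; case: pselect => // Yv ->.
move=> x _; apply: (@cvg_comp _ _ _ (fun k => ungrid k (grid k x)) f _ (nbhs x)).
  apply/cvg_ballP => e e0.
  have [N _ hN] := (@cvgrPdist_lt _ _ _ _ _ _ _).1 (@cvg_harmonic R) _ e0.
  exists N => // k /hN; rewrite /= sub0r normrN ger0_norm// => ke.
  by split => // i j; rewrite /ball/=; exact: le_lt_trans (ungrid_near _ _ _ _) ke.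
exact: cf.
Qed.

End rV_topology.

Section convex_continuous.
Context {R : realType}.

Definition convex_fun n (f : 'rV[R]_n -> R) := forall x y (t : R), 0 <= t <= 1 ->
  f (t *: x + (1 - t) *: y) <= t * f x + (1 - t) * f y.

Lemma strictly_convexW n (f : 'rV[R]_n -> R) : strictly_convex f -> convex_fun f.
Proof.
move=> sf x y t /andP[t0 t1].
have [<-|xy] := eqVneq x y; first by rewrite -scalerDl -mulrDl subrKC scale1r mul1r.
have [->|tn0] := eqVneq t 0; first by rewrite scale0r mul0r !add0r subr0 scale1r mul1r.
have [->|tn1] := eqVneq t 1; first by rewrite subrr scale0r mul0r !addr0 scale1r mul1r.
by rewrite ltW// sf// !lt_neqAle t0 t1 eq_sym tn0 tn1.
Qed.

(** A convex function on a cube is bounded by its values at the vertices; one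
    coordinate at a time, each point lies between two opposite faces. *)
Lemma convex_fun_cube_bounded n (f : 'rV[R]_n -> R) : convex_fun f ->
  exists M, forall x, cube (-1) 1 x -> f x <= M.
Proof.
elim: n f => [|n IH] f cf.
  by exists (f 0) => x _; rewrite (_ : x = 0)//; apply/rowP => -[].
have consE s t u x y : rV_cons (t * s + (1 - t) * u, t *: x + (1 - t) *: y) =
    t *: rV_cons (s, x) + (1 - t) *: rV_cons (u, y) :> 'rV[R]_n.+1.
  apply/rowP => i; rewrite [RHS]mxE [X in _ = X + _]mxE [X in _ = _ + X]mxE.
  case: (unliftP ord0 i) => [j|] ->; last by rewrite !rV_cons0.
  by rewrite !rV_consS/= !mxE.
have cfs s : convex_fun (fun y : 'rV[R]_n => f (rV_cons (s, y))).
  move=> x y t t01; have := cf (rV_cons (s, x)) (rV_cons (s, y)) t t01.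
  by rewrite -consE -mulrDl subrKC mul1r.
have [M1 fM1] := IH _ (cfs 1); have [M2 fM2] := IH _ (cfs (-1)).
exists (Num.max M1 M2) => x Qx.
rewrite -(rV_unconsK x); case: (rV_uncons x) (rV_unconsK x) => s y xE.
move: Qx; rewrite -xE => /cube_cons[/=]; rewrite in_itv/= => /andP[s1 s2] Qy.
pose t := (1 + s) / 2.
have t01 : 0 <= t <= 1 by rewrite /t; apply/andP; split; lra.
have /andP[t0 t1] := t01.
have := cf (rV_cons (1, y)) (rV_cons (-1, y)) t t01.
rewrite -consE -scalerDl subrKC scale1r (_ : _ + _ * -1 = s); last by rewrite /t; lra.
move=> /le_trans; apply.
have -> : Num.max M1 M2 = t * Num.max M1 M2 + (1 - t) * Num.max M1 M2.
  by rewrite -mulrDl subrKC mul1r.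
by rewrite lerD// ler_wpM2l// ?subr_ge0// le_max ?fM1 ?fM2 ?orbT.
Qed.

(** Writing u as a convex combination of 0 and u / |u|, and 0 as one of u and
    - u / |u|, the bound on the cube becomes a Lipschitz bound at 0. *)
Lemma convex_fun_continuous n (f : 'rV[R]_n -> R) : convex_fun f -> continuous f.
Proof.
move=> cf x0.
pose g u := f (x0 + u).
have cg : convex_fun g.
  move=> x y t t01; apply: le_trans (cf _ _ t t01); rewrite le_eqVlt; apply/orP; left.
  by apply/eqP; congr f; rewrite !scalerDr addrACA -scalerDl subrKC scale1r.
have [M gM] := convex_fun_cube_bounded cg.
have unit_cube (u : 'rV[R]_n) : `|u| <= 1 -> cube (-1) 1 u.
  by move=> u1 i; rewrite -ler_norml (le_trans (norm_coord_le u i)).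
pose D := M - g 0.
have Lip u : `|u| <= 1 -> `|g u - g 0| <= `|u| * D.
  move=> u1; have [->|u0] := eqVneq u 0; first by rewrite normr0 mul0r subrr normr0.
  pose t := `|u|; have t0 : 0 < t by rewrite normr_gt0.
  have tV : `|t^-1 *: u| <= 1 by rewrite normrZ gtr0_norm ?invr_gt0// mulVf// gt_eqF.
  have h1 : g u <= t * M + (1 - t) * g 0.
    have := cg (t^-1 *: u) 0 t; rewrite (ltW t0) u1 => /(_ isT).
    rewrite scalerA divff ?gt_eqF// scale1r scaler0 addr0 => /le_trans; apply.
    by rewrite lerD2r ler_wpM2l ?(ltW t0)// gM//; exact: unit_cube.
  have h2 : (1 + t) * g 0 <= g u + t * M.
    have t1 : 0 < 1 + t by rewrite ltr_pwDl// ltW.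
    have := cg u (- (t^-1 *: u)) (1 + t)^-1.
    rewrite invr_ge0 (ltW t1) invf_le1// lerDl (ltW t0) => /(_ isT).
    have -> : 1 - (1 + t)^-1 = (1 + t)^-1 * t by field; rewrite gt_eqF.
    rewrite -scalerA -mulrA -scalerDr scalerN scalerA divff ?gt_eqF// scale1r subrr scaler0.
    rewrite -mulrDr -(ler_pM2l t1) mulrA divff ?gt_eqF// mul1r => /le_trans; apply.
    by rewrite lerD2l ler_wpM2l ?(ltW t0)// gM//; apply: unit_cube; rewrite normrN.
  rewrite -/t ler_norml /D; apply/andP; split; lra.
have D0 : 0 <= D by rewrite subr_ge0 gM//; apply: unit_cube; rewrite normr0.
apply/(@cvgrPdist_lt _ _ _ (nbhs x0) (nbhs_filter x0)) => e e0.
near=> x.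
have xx0 : `|x - x0| < Num.min 1 (e / (D + 1)).
  near: x; apply/nbhs_ballP; exists (Num.min 1 (e / (D + 1))).
    by rewrite /= lt_min ltr01 divr_gt0// ltr_wpDl.
  by move=> y; rewrite -ball_normE/= distrC.
move: xx0; rewrite lt_min => /andP[x1 xe].
have := Lip _ (ltW x1); rewrite /g subrKC addr0 distrC => /le_lt_trans; apply.
rewrite ltr_pdivlMr in xe; last by rewrite ltr_wpDl.
by apply: le_lt_trans xe; rewrite ler_wpM2l// lerDl.
Unshelve. all: by end_near. Qed.

End convex_continuous.

Section partial_derivatives.
Context {R : realType} {n : nat}.
Implicit Types f : 'rV[R]_n -> R.

Lemma partial_cvg f (i : 'I_n) x : differentiable f x ->
  (fun k => k.+1%:R * (f (k.+1%:R^-1 *: delta_mx ord0 i + x) - f x)) @ \oo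
    --> partial i f x.
Proof.
move=> df.
have dv : derivable f x (delta_mx ord0 i) by exact: diff_derivable.
have dvc : t^-1 * (f (t *: delta_mx ord0 i + x) - f x) @[t --> (0 : R)^'] -->
  partial i f x by exact: dv.
have /cvgr_dnbhsP/(_ (fun k => k.+1%:R^-1)) := dvc.
rewrite (_ : (fun k => _^-1^-1 * _) = (fun k => k.+1%:R *
    (f (k.+1%:R^-1 *: delta_mx ord0 i + x) - f x))); last first.
  by apply/funext => k; rewrite invrK.
by apply; split => [k|]; [rewrite invr_neq0//|exact: cvg_harmonic].
Qed.

Lemma differentiable_continuous_rV f : (forall x, differentiable f x) -> continuous f.
Proof. by move=> df x; exact: differentiable_continuous. Qed.

Lemma measurable_partial f (i : 'I_n) : (forall x, differentiable f x) ->
  measurable_fun setT (partial i f).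
Proof.
move=> df; have cf := differentiable_continuous_rV df.
apply: (measurable_fun_cvg (h := fun k x => k.+1%:R *
  (f (k.+1%:R^-1 *: delta_mx ord0 i + x) - f x))); last first.
  by move=> x _; exact: partial_cvg.
move=> k.
apply: measurable_funM => //; apply: measurable_funB.
  apply: continuous_measurable_rV => x.
  apply: (@cvg_comp _ _ _ (fun y => k.+1%:R^-1 *: delta_mx ord0 i + y) f _
    (nbhs (k.+1%:R^-1 *: delta_mx ord0 i + x))); last exact: cf.
  by apply: (@cvgD _ _ _ (nbhs x) _ (cst _) id); [exact: cvg_cst|exact: cvg_id].
exact: continuous_measurable_rV.
Qed.

Lemma is_derive_line f (i : 'I_n) x (s : R) : differentiable f (set_coord x i s) ->
  is_derive s 1 (fun t => f (set_coord x i t)) (partial i f (set_coord x i s)).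
Proof.
move=> df.
have dv : derivable f (set_coord x i s) (delta_mx ord0 i) by exact: diff_derivable.
have e : (fun h : R => h^-1 *: (((fun t => f (set_coord x i t)) \o shift s) (h *: (1 : R)) -
       f (set_coord x i s))) =
   (fun h : R => h^-1 *: ((f \o shift (set_coord x i s)) (h *: delta_mx ord0 i) -
       f (set_coord x i s))).
  apply/funext => h /=; congr (_ *: (f _ - _)).
  apply/rowP => j; rewrite !mxE eqxx/= /GRing.scale/= mulr1.
  by case: eqP => _; rewrite ?mulr1 ?mulr0 ?add0r.
by apply: DeriveDef; rewrite /derivable /derive e.
Qed.

End partial_derivatives.

(** * Vertices avoiding a null set, and change of density *)

Section box_vertices.
Context {R : realType}.
Notation leb := (@lebesgue_measure R).

Lemma negligible_itv_avoid (X : set (measurableTypeR R)) (a b : R) : a < b ->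
  leb.-negligible X -> exists x, [/\ a < x, x < b & ~ X x].
Proof.
move=> ab [A [mA A0 XA]]; apply: contrapT => nex.
have sub : (`]a, b[%classic : set (measurableTypeR R)) `<=` A.
  move=> x; rewrite /= in_itv/= => /andP[ax xb]; apply: contrapT => nAx.
  by apply: nex; exists x; split => // /XA.
have := le_measure leb (mem_set (measurable_itv _)) (mem_set mA) sub.
rewrite /= A0 lebesgue_measure_itv/= lte_fin ab -EFinD lee_fin.
by rewrite leNgt subr_gt0 ab.
Qed.

(** By Fubini, almost every slice of N is null.  Two distinct good values s < t of
    the first coordinate give the first side of the box, and the induction
    hypothesis applied to the union of the two slices gives the others. *)
Lemma negligible_box_vertices n (N : set 'rV[R]_n) :
  (lebesgue_rV n).-negligible N ->
  exists p q : 'rV[R]_n, (forall i, p ord0 i < q ord0 i) /\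
    forall v : 'rV[R]_n, (forall i, v ord0 i = p ord0 i \/ v ord0 i = q ord0 i) -> ~ N v.
Proof.
elim: n N => [|n IH] N [A [mA A0 NA]].
  exists 0, 0; split => [[]//|v _ Nv].
  have v0 : v = 0 by apply/rowP => -[].
  move: A0; rewrite /= diracE mem_set; last by rewrite -v0; exact: NA.
  by move/eqP; rewrite eqe oner_eq0.
pose B := @rV_cons R n @^-1` A.
have mB : measurable B.
  by rewrite /B -[X in measurable X]setTI; exact: measurable_rV_cons.
have B0 : (\int[leb]_x `|(lebesgue_rV n \o xsection B) x|)%E = 0%E.
  under eq_integral do rewrite gee0_abs//; exact: A0.
have /ae_eq_integral_abs : measurable_fun setT (lebesgue_rV n \o xsection B).
  exact: measurable_fun_xsection.
move=> /(_ leb measurableT) [/(_ B0) aeB _].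
pose X := [set x | lebesgue_rV n (xsection B x) <> 0%E].
have Xneg : leb.-negligible X.
  by move: aeB; apply: negligibleS => x /= nx h; apply: nx; exact: h.
have [s [_ s1 nXs]] := negligible_itv_avoid (@ltr01 R) Xneg.
have [t [t1 _ nXt]] := negligible_itv_avoid (ltr1n R 2 : 1 < 2%:R) Xneg.
have sec u : ~ X u -> (lebesgue_rV n).-negligible (xsection B u).
  move=> nXu; apply/negligibleP; first exact: measurable_xsection.
  exact: contrapT.
have [p [q [pq pqv]]] := IH _ (negligibleU (sec _ nXs) (sec _ nXt)).
exists (rV_cons (s, p)), (rV_cons (t, q)); split.
  move=> i; case: (unliftP ord0 i) => [j|] ->; rewrite ?rV_consS//= !rV_cons0/=.
  exact: lt_trans s1 t1.
move=> v vpq Nv; have := NA _ Nv; rewrite -(rV_unconsK v).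
move=> Av; apply: (pqv (rV_uncons v).2).
  by move=> i; have := vpq (lift ord0 i); rewrite !rV_consS /= mxE.
have := vpq ord0; rewrite !rV_cons0/= => -[e|e]; [left|right];
  by apply/xsectionP; rewrite /B/= -e; move: Av; rewrite /rV_uncons.
Qed.

End box_vertices.

Section density.
Context {R : realType} {n : nat}.
Variables (mu : probability 'rV[R]_n R) (V : 'rV[R]_n -> R).
Hypothesis V_cont : continuous V.
Hypothesis mu_density : forall A : set 'rV[R]_n, measurable A ->
  mu A = (\int[lebesgue_rV n]_(x in A) (expR (- V x))%:E)%E.
Notation leb := (lebesgue_rV n).

Lemma measurable_density : measurable_fun setT (fun x => expR (- V x)).
Proof.
apply: continuous_measurable_rV => x.
apply: (@cvg_comp _ _ _ (fun y => - V y) expR _ (nbhs (- V x))).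
  by apply: (@cvgN _ _ _ (nbhs x) _ V (V x)); exact: V_cont.
exact: continuous_expR.
Qed.

Lemma density_dominates : mu `<< leb.
Proof.
apply/null_content_dominatesP => A mA A0.
rewrite mu_density//; apply: null_set_integral => //.
by apply/measurable_EFinP; apply: measurable_funTS; exact: measurable_density.
Qed.

(** The density e^(-V) is positive everywhere. *)
Lemma density_negligible A : mu.-negligible A -> leb.-negligible A.
Proof.
move=> [B [mB B0 AB]]; exists B; split => //.
have mV : measurable_fun B (fun x => (expR (- V x))%:E).
  by apply/measurable_EFinP; apply: measurable_funTS; exact: measurable_density.
have : (\int[leb]_(x in B) `|(expR (- V x))%:E|)%E = 0%E.
  under eq_integral do rewrite gee0_abs ?lee_fin ?expR_ge0//.
  by rewrite -mu_density.
move/(ae_eq_integral_abs leb mB mV) => ae.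
apply: measure_negligible => //; apply: negligibleS ae => x Bx /= h.
by have /eqP := h Bx; rewrite eqe gt_eqF// expR_gt0.
Qed.

(** Since mu is absolutely continuous, e^(-V) agrees almost everywhere with its
    Radon-Nikodym derivative, for which the formula is known. *)
Lemma ge0_integral_density (h : 'rV[R]_n -> \bar R) : measurable_fun setT h ->
  (forall x, 0 <= h x)%E ->
  (\int[mu]_x h x)%E = (\int[leb]_x (h x * (expR (- V x))%:E))%E.
Proof.
move=> mh h0.
rewrite -(Radon_Nikodym_SigmaFinite.change_of_variables density_dominates)//.
have mV : measurable_fun setT (fun x => (expR (- V x))%:E).
  by apply/measurable_EFinP; exact: measurable_density.
have iRN := Radon_Nikodym_SigmaFinite.f_integrable density_dominates.
have mRN := measurable_int _ iRN.
apply: ae_eq_integral => //.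
- exact: emeasurable_funM.
- exact: emeasurable_funM.
- apply: ae_eqe_mul2l; apply: integral_ae_eq => // E _ mE.
  by rewrite -mu_density// (Radon_Nikodym_SigmaFinite.f_integral density_dominates mE).
Qed.

Lemma bint_density (Q : set 'rV[R]_n) (h : 'rV[R]_n -> R) K :
  measurable Q -> (leb Q < +oo)%E -> (forall x, Q x -> expR (- V x) <= K) ->
  bounded_on Q h ->
  \int[mu]_x h x = \int[leb]_x (h x * expR (- V x)).
Proof.
move=> mQ Qfin VK bh; have [mh [M hM]] := bh.
have muQ : (mu Q < +oo)%E by apply: (le_lt_trans (probability_le1 mu mQ)); rewrite ltry.
have ge0 (f : 'rV[R]_n -> R) : measurable_fun setT f -> (forall x, 0 <= f x) ->
    \int[mu]_x f x = \int[leb]_x (f x * expR (- V x)).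
  move=> mf f0; rewrite /Rintegral ge0_integral_density//.
  by apply/measurable_EFinP.
have bV f : bounded_on Q f -> bounded_on Q (fun x => f x * expR (- V x)).
  move=> bf; apply: (@bounded_onM _ _ _ Q _ _ K) => //; first exact: measurable_density.
  by move=> x Qx; rewrite ger0_norm ?expR_ge0// VK.
(* h is the difference of two nonnegative functions vanishing outside Q *)
pose f2 x := `|M| * \1_Q x : R; pose f1 x := h x + f2 x.
have bf2 : bounded_on Q f2 by apply: bounded_onZ; exact: bounded_on_indic1.
have bf1 : bounded_on Q f1 by exact: bounded_onD.
have f2_ge0 x : 0 <= f2 x by rewrite mulr_ge0.
have f1_ge0 x : 0 <= f1 x.
  rewrite -lerBlDr sub0r; have := hM x; rewrite ler_norml => /andP[+ _].
  by apply: le_trans; rewrite lerN2 ler_wpM2r// ler_norm.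
have -> : h = (fun x => f1 x - f2 x) by apply/funext => x; rewrite /f1 addrK.
rewrite (bintB mQ muQ)//.
under [RHS]eq_Rintegral do rewrite mulrBl.
rewrite (bintB mQ Qfin) ?ge0//; [exact: bf2.1|exact: bf1.1|exact: bV|exact: bV].
Qed.

End density.

(** * The entropy inequality on a cube *)

Section cube_entropy.
Context {R : realType} {n : nat}.
Variables (a b : R) (p q : 'rV[R]_n).
Hypothesis ab : a < b.
Hypothesis pq_in : forall i, [/\ a <= p ord0 i, p ord0 i < q ord0 i & q ord0 i <= b].
Notation Q := (cube a b : set 'rV[R]_n).
Implicit Types G : 'rV[R]_n -> R.

Definition box_vertex (S : {set 'I_n}) : 'rV[R]_n :=
  \row_i (if i \in S then q ord0 i else p ord0 i).

(** The maximum of (x - v) . grad G x over the vertices v of the box, computed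
    one coordinate at a time. *)
Definition drift G (x : 'rV[R]_n) : R := \sum_(i < n)
  Num.max ((x ord0 i - p ord0 i) * partial i G x)
          ((x ord0 i - q ord0 i) * partial i G x).

Lemma drift_vertex G x : exists S, drift G x = dotv (x - box_vertex S) (grad G x).
Proof.
exists [set i | (x ord0 i - p ord0 i) * partial i G x <
                (x ord0 i - q ord0 i) * partial i G x]%SET.
apply: eq_bigr => i _; rewrite !mxE inE /Num.max.
by case: ifPn.
Qed.

Lemma set_coord_id (x : 'rV[R]_n) i : set_coord x i (x ord0 i) = x.
Proof. by apply/rowP => j; rewrite mxE; case: eqP => [->|]. Qed.

Lemma set_coord_cube (x : 'rV[R]_n) i s : Q x ->
  (\1_Q (set_coord x i s) : R) = \1_`[a, b] s.
Proof.
move=> Qx; rewrite !indicE; congr (nat_of_bool _)%:R.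
apply/idP/idP; rewrite !inE.
  by move=> /(_ i); rewrite mxE eqxx /= in_itv.
rewrite /= in_itv/= => sab j; rewrite mxE; case: eqP => // _; exact: Qx.
Qed.

Let mQ := measurable_cube (n := n) a b.
Let Qfin : (lebesgue_rV n Q < +oo)%E.
Proof. by rewrite lebesgue_cube ?ltry// ltW. Qed.

Lemma pinched_on_cube G : continuous G -> (forall x, 0 < G x) ->
  pinched_on Q (fun x => \1_Q x * G x).
Proof.
move=> cG G0; split.
- by apply: measurable_funM => //; exact: continuous_measurable_rV.
- by move=> x nQ; rewrite indicE memNset// mul0r.
- have clnG : {within Q, continuous (fun x => ln (G x))}.
    apply: continuous_subspaceT => x.
    by apply: continuous_comp; [exact: cG|exact: continuous_ln].
  have [K lnGK] := compact_continuous_bounded (@compact_cube R n a b) clnG.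
  exists (expR (- K)), (expR K); split; first exact: expR_gt0.
  move=> x Qx; rewrite indicE mem_set// mul1r -{1 2}(lnK (G0 x)) !ler_expR.
  by have := lnGK x Qx; rewrite ler_norml.
Qed.

Lemma bounded_on_cube G : continuous G -> bounded_on Q (fun x => \1_Q x * G x).
Proof.
move=> cG; have [K GK] := compact_continuous_bounded (@compact_cube R n a b)
  (continuous_subspaceT cG).
by apply: bounded_on_indic GK => //; exact: continuous_measurable_rV.
Qed.

Variable G : 'rV[R]_n -> R.
Hypothesis dG : forall x, differentiable G x.
Hypothesis G_gt0 : forall x, 0 < G x.
Hypothesis dG_bounded : forall i, exists K, forall x, cube (a - 1) (b + 1) x ->
  `|partial i G x| <= K.

Let cG : continuous G. Proof. exact: differentiable_continuous_rV. Qed.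

Lemma bounded_on_drift_coord i (u : R) : a <= u <= b ->
  bounded_on Q (fun x => \1_Q x * ((x ord0 i - u) * partial i G x)).
Proof.
move=> /andP[au ub]; have [K GK] := dG_bounded i.
apply: (@bounded_on_indic _ _ _ Q mQ _ ((b - a) * K)).
  apply: measurable_funM; last exact: measurable_partial.
  by apply: measurable_funB => //; exact: measurable_coord.
move=> x Qx; have /andP[x1 x2] := Qx i.
rewrite normrM ler_pM//; last first.
  by apply: GK => j; have /andP[y1 y2] := Qx j; apply/andP; split; lra.
by rewrite ler_norml; apply/andP; split; lra.
Qed.

Let H i x : R := \1_Q x *
  (Num.max ((x ord0 i - p ord0 i) * partial i G x)
           ((x ord0 i - q ord0 i) * partial i G x) - ln (q ord0 i - p ord0 i) * G x).

Let bH i : bounded_on Q (H i).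
Proof.
have [ap pq qb] := pq_in i.
have b1 : bounded_on Q (fun x => \1_Q x * ((x ord0 i - p ord0 i) * partial i G x)).
  by apply: bounded_on_drift_coord; apply/andP; split; lra.
have b2 : bounded_on Q (fun x => \1_Q x * ((x ord0 i - q ord0 i) * partial i G x)).
  by apply: bounded_on_drift_coord; apply/andP; split; lra.
have [K1 h1] := b1.2; have [K2 h2] := b2.2.
have -> : H i = (fun x =>
    Num.max (\1_Q x * ((x ord0 i - p ord0 i) * partial i G x))
      (\1_Q x * ((x ord0 i - q ord0 i) * partial i G x)) -
    ln (q ord0 i - p ord0 i) * (\1_Q x * G x)).
  apply/funext => x; rewrite /H mulrBr maxr_pMr//; congr (_ - _); ring.
apply: bounded_onB; last by apply: bounded_onZ; exact: bounded_on_cube.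
split; first by apply: measurable_maxr; [exact: b1.1|exact: b2.1].
exists (Num.max K1 K2) => x /=; rewrite {1}/Num.max; case: ifPn => _.
  by rewrite (le_trans (h2 x))// ler_wpM2r// le_max lexx orbT.
by rewrite (le_trans (h1 x))// ler_wpM2r// le_max lexx.
Qed.

Lemma bounded_on_drift : bounded_on Q (fun x => \1_Q x * drift G x).
Proof.
rewrite (_ : (fun _ => _) = (fun x =>
  \sum_(i < n) (H i x + ln (q ord0 i - p ord0 i) * (\1_Q x * G x)))); last first.
  apply/funext => x; rewrite /drift big_distrr/=; apply: eq_bigr => i _.
  rewrite /H; ring.
apply: bounded_on_sum => // i; apply: bounded_onD; first exact: bH.
by apply: bounded_onZ; exact: bounded_on_cube.
Qed.

(** The one-dimensional inequality on every coordinate line, tensorized. *)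
Theorem entropy_le_drift :
  entropy (lebesgue_rV n) (fun x => \1_Q x * G x) <=
  \int[lebesgue_rV n]_x (\1_Q x * drift G x) -
  (\sum_(i < n) ln (q ord0 i - p ord0 i)) * \int[lebesgue_rV n]_x (\1_Q x * G x).
Proof.
have bG := bounded_on_cube cG.
rewrite -(bintZ mQ Qfin)// -(bintB mQ Qfin)//; last 2 first.
- exact: bounded_on_drift.
- exact: bounded_onZ.
rewrite [leRHS](_ : _ = \int[lebesgue_rV n]_x (\sum_(i < n) H i x)); last first.
  apply: eq_Rintegral => x _; rewrite /drift big_distrr big_distrl -sumrB/=.
  by apply: eq_bigr => i _; rewrite /H; ring.
rewrite (bint_sum mQ Qfin)//.
apply: (entropy_le_sum_lines ab) => //; first exact: pinched_on_cube.
move=> i x Qx.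
have [ap pq qb] := pq_in i.
have [K GK] := dG_bounded i.
have mline : measurable_fun setT (fun s : R => set_coord x i s).
  apply: measurable_fun_rVP => j; under eq_fun do rewrite mxE.
  by case: (j == i); [exact: measurable_id|exact: measurable_cst].
rewrite (_ : (fun s => \1_Q (set_coord x i s) * G (set_coord x i s)) =
  (fun s => \1_`[a, b] s * G (set_coord x i s))); last first.
  by apply/funext => s; rewrite set_coord_cube.
rewrite [leRHS](_ : _ = \int[lebesgue_measure]_s (\1_`[a, b] s *
    (Num.max ((s - p ord0 i) * partial i G (set_coord x i s))
             ((s - q ord0 i) * partial i G (set_coord x i s)) -
     ln (q ord0 i - p ord0 i) * G (set_coord x i s)))); last first.
  by apply: eq_Rintegral => s _; rewrite /H set_coord_cube// mxE eqxx.
apply: (@entropy_le_line R (fun s => G (set_coord x i s))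
  (fun s => partial i G (set_coord x i s)) a b (p ord0 i) (q ord0 i) K ap pq qb).
- by apply: measurableT_comp => //; exact: measurable_partial.
- by move=> s; exact: is_derive_line.
- by move=> s.
- move=> s sab; apply: GK => j; rewrite mxE; case: eqP => // _.
  by have /andP[y1 y2] := Qx j; apply/andP; split; lra.
Qed.

End cube_entropy.

(** * The pointwise bound *)

Section dot_product.
Context {R : realType} {n : nat}.
Implicit Types x y z : 'rV[R]_n.

Lemma dotvC x y : dotv x y = dotv y x.
Proof. by apply: eq_bigr => i _; rewrite mulrC. Qed.

Lemma dotvNl x y : dotv (- x) y = - dotv x y.
Proof. by rewrite /dotv -sumrN; apply: eq_bigr => i _; rewrite mxE mulNr. Qed.

Lemma dotvZr (k : R) x y : dotv x (k *: y) = k * dotv x y.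
Proof. by rewrite /dotv big_distrr; apply: eq_bigr => i _; rewrite mxE mulrCA. Qed.

Lemma dotvBr x y z : dotv x (y - z) = dotv x y - dotv x z.
Proof.
by rewrite /dotv -sumrB; apply: eq_bigr => i _; rewrite !mxE mulrBr.
Qed.

Lemma dotv_delta i y : dotv (delta_mx ord0 i) y = y ord0 i.
Proof.
rewrite /dotv (bigD1 i)//= big1 => [|j ji]; last by rewrite mxE (negbTE ji) mul0r.
by rewrite mxE !eqxx mul1r addr0.
Qed.

End dot_product.

Section semiconvex.
Context {R : realType} {n : nat}.
Variables (V c : 'rV[R]_n -> R) (lambda : R).
Hypothesis V_diff : forall x, differentiable V x.
Hypothesis V_lower : forall x u : 'rV[R]_n,
  V (x + u) >= V x + dotv u (grad V x) - lambda * c u.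

(** Applying the lower bound on V with u = e_i and u = - e_i traps the partial
    derivative between differences of values of V, which is continuous. *)
Lemma semiconvex_partial_bounded i (a b : R) :
  exists K, forall x, cube a b x -> `|partial i V x| <= K.
Proof.
have cV := differentiable_continuous_rV V_diff.
have [M VM] := compact_continuous_bounded (@compact_cube R n (a - 1) (b + 1))
  (continuous_subspaceT cV).
pose e : 'rV[R]_n := delta_mx ord0 i.
exists (M + M + `|lambda * c e| + `|lambda * c (- e)|) => x Qx.
have Vx : `|V x| <= M.
  by apply: VM => j; have /andP[x1 x2] := Qx j; apply/andP; split; lra.
have shift u : (u = e \/ u = - e) -> `|V (x + u)| <= M.
  move=> ue; apply: VM => j; have /andP[x1 x2] := Qx j.
  have : -1 <= u ord0 j <= 1.
    by case: ue => ->; rewrite !mxE /=; case: (j == i) => /=;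
      apply/andP; split; rewrite ?mulr1n ?mulr0n ?oppr0; lra.
  by move=> /andP[u1 u2]; rewrite mxE; apply/andP; split; lra.
have h1 := V_lower x e; have h2 := V_lower x (- e).
rewrite dotvNl in h2; rewrite dotv_delta mxE in h1 h2.
have := shift e (or_introl erefl); have := shift (- e) (or_intror erefl).
move: Vx; rewrite !ler_norml => /andP[v1 v2] /andP[m1 m2] /andP[p1 p2].
have l1 := ler_norm (lambda * c e); have l2 := ler_norm (lambda * c (- e)).
have l3 := normr_ge0 (lambda * c e); have l4 := normr_ge0 (lambda * c (- e)).
by apply/andP; split; lra.
Qed.

End semiconvex.

Section weighted_density.
Context {R : realType} {n : nat}.
Variables (f V : 'rV[R]_n -> R) (eta : R).
Hypothesis f_diff : forall x, differentiable f x.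
Hypothesis V_diff : forall x, differentiable V x.

(** The density of (f^2 + eta) mu; eta > 0 keeps it positive where f vanishes. *)
Definition weighted (x : 'rV[R]_n) : R := (f x ^+ 2 + eta) * expR (- V x).

Lemma differentiable_weighted x : differentiable weighted x.
Proof.
rewrite (_ : weighted = ((f * f) + cst eta) * (expR \o (- V))); last first.
  by apply/funext => y; rewrite /weighted expr2.
apply: differentiableM.
  by apply: differentiableD => //; exact: differentiableM.
apply: differentiable_comp; first exact: differentiableN.
by apply/derivable1_diffP; exact: derivable_expR.
Qed.

(** On the line through x in direction i this is calculus in one variable. *)
Lemma partial_weighted i x : partial i weighted x =
  (2 * f x * partial i f x - (f x ^+ 2 + eta) * partial i V x) * expR (- V x).
Proof.
have dw := is_derive_line (i := i) (x := x) (s := x ord0 i)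
  (differentiable_weighted (set_coord x i (x ord0 i))).
have df := is_derive_line (i := i) (x := x) (s := x ord0 i)
  (f_diff (set_coord x i (x ord0 i))).
have dV := is_derive_line (i := i) (x := x) (s := x ord0 i)
  (V_diff (set_coord x i (x ord0 i))).
rewrite !set_coord_id in dw df dV.
have dE : is_derive (x ord0 i) 1 (expR \o (fun t => - V (set_coord x i t)))
    (expR (- V x) * - partial i V x).
  have d1 : is_derive (- V (set_coord x i (x ord0 i))) 1 expR (expR (- V x)).
    by rewrite set_coord_id; exact: is_derive_expR.
  exact: (@is_derive1_comp R expR (fun t => - V (set_coord x i t)) _ _ _ d1
    (is_deriveN dV)).
have := is_deriveM (is_deriveD (is_deriveM df df) (is_derive_cst eta (x ord0 i) 1)) dE.
set F := (X in is_derive _ _ X _).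
have -> : F = (fun t => weighted (set_coord x i t)).
  by apply/funext => t; rewrite /F /weighted expr2.
move=> [_ e]; case: dw => _; rewrite e => <-.
rewrite /GRing.scale/= !fctE/= set_coord_id; ring.
Qed.

Lemma grad_weighted x : grad weighted x =
  expR (- V x) *: ((2 * f x) *: grad f x - (f x ^+ 2 + eta) *: grad V x).
Proof.
by apply/rowP => i; rewrite !mxE partial_weighted; ring.
Qed.

End weighted_density.

Section pointwise_bound.
Context {R : realType} {n : nat}.
Variables (V c f : 'rV[R]_n -> R) (lambda eps eta : R).
Hypothesis V_diff : forall x, differentiable V x.
Hypothesis f_diff : forall x, differentiable f x.
Hypothesis V_lower : forall x u : 'rV[R]_n,
  V (x + u) >= V x + dotv u (grad V x) - lambda * c u.
Hypotheses (lambda_ge0 : 0 <= lambda) (eps_gt0 : 0 < eps) (eta_gt0 : 0 < eta).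
Hypotheses (c_ge0 : forall x, 0 <= c x) (c_even : forall x, c (- x) = c x).
Hypothesis c0 : c 0 = 0.

Let e' := eps / 2.
Let dl := (lambda + e') / (lambda + eps).
Let g x : R := f x ^+ 2 + eta.

Definition fisher_density (K : R) (x : 'rV[R]_n) : \bar R :=
  (if (f x == 0)%R then 0
   else (f x ^+ 2)%:E * convex_conjugate c ((K * f x)^-1 *: grad f x)%R)%E.

Lemma convex_conjugate_ge0 x : (0 <= convex_conjugate c x)%E.
Proof.
apply: ereal_sup_ubound; exists 0 => //.
by rewrite c0 subr0 /dotv big1// => i _; rewrite mxE mulr0.
Qed.

Lemma fisher_density_ge0 K x : (0 <= fisher_density K x)%E.
Proof.
rewrite /fisher_density; case: ifPn => // _.
by rewrite mule_ge0 ?lee_fin ?sqr_ge0// convex_conjugate_ge0.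
Qed.

(** K2 = eps / 4 is chosen so that 2 f grad f = (eps / 2) f^2 * grad f / (K2 f). *)
Lemma fenchel_young x u : ((dotv u (2 * f x *: grad f x) - e' * f x ^+ 2 * c u)%:E <=
  e'%:E * fisher_density (eps / 4) x)%E.
Proof.
have e'0 : 0 < e' by rewrite divr_gt0.
rewrite /fisher_density; case: ifPn => [/eqP fx0|fx0].
  rewrite mule0 lee_fin fx0 mulr0 scale0r expr0n/= mulr0 mul0r subr0.
  by rewrite /dotv big1// => i _; rewrite mxE mulr0.
have k0 : 0 <= e' * f x ^+ 2 by rewrite mulr_ge0 ?sqr_ge0// ltW.
rewrite muleA -EFinM.
apply: (@le_trans _ _ ((e' * f x ^+ 2)%:E *
   (dotv ((eps / 4 * f x)^-1 *: grad f x) u - c u)%:E)%E); last first.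
  apply: lee_wpmul2l; first by rewrite lee_fin.
  by apply: ereal_sup_ubound; exists u.
rewrite -EFinM lee_fin mulrBr lerD2r dotvZr [dotv (_ *: _) u]dotvC dotvZr mulrA.
rewrite le_eqVlt; apply/orP; left; apply/eqP; congr (_ * _).
rewrite /e'; field.
by rewrite fx0 gt_eqF.
Qed.

(** The constant dl satisfies dl * (lambda + eps) = lambda + eps / 2, which is the
    total coefficient of c (v - x) coming from V and from Fenchel-Young. *)
Lemma drift_pointwise x v CB E Z : V v <= CB ->
  expR ((lambda + eps) * c (v - x)) <= E -> 0 < Z ->
  ((expR (V x) * dotv (x - v) (grad (weighted f V eta) x) -
    (g x * (CB - V x) + dl * (g x * (ln (g x) - ln Z) + Z * E)))%:E <=
   e'%:E * fisher_density (eps / 4) x)%E.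
Proof.
move=> VCB cE Z0; apply: le_trans (fenchel_young x (x - v)); rewrite lee_fin.
have g0 : 0 < g x by rewrite ltr_wpDl ?sqr_ge0.
have le0 : 0 < lambda + eps by rewrite ltr_wpDl.
rewrite grad_weighted// dotvZr mulrA -expRD subrr expR0 mul1r dotvBr.
rewrite [X in _ - X - _ <= _]dotvZr -/(g x).
have cv : c (v - x) = c (x - v) by rewrite -opprB c_even.
have hV : - dotv (x - v) (grad V x) <= CB - V x + lambda * c (v - x).
  have := V_lower x (v - x); rewrite subrKC => h.
  by rewrite -dotvNl opprB; lra.
(* duality between entropy and exponential moments *)
have young : g x * ((lambda + eps) * c (v - x)) <= g x * (ln (g x) - ln Z) + Z * E.
  have Ze : 0 < Z * expR ((lambda + eps) * c (v - x)) by rewrite mulr_gt0 ?expR_gt0.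
  have := log_sum_pointwise g0 Ze; rewrite lnM ?posrE ?expR_gt0// expRK => h.
  have : Z * expR ((lambda + eps) * c (v - x)) <= Z * E by rewrite ler_wpM2l// ltW.
  lra.
have fg : f x ^+ 2 <= g x by rewrite lerDl ltW.
have h1 : e' * f x ^+ 2 * c (x - v) <= g x * (e' * c (v - x)).
  rewrite cv mulrAC mulrC ler_wpM2r// mulr_ge0// divr_ge0// ltW//.
have h2 : dl * (g x * ((lambda + eps) * c (v - x))) <=
    dl * (g x * (ln (g x) - ln Z) + Z * E).
  rewrite ler_wpM2l// divr_ge0// ?(ltW le0)// addr_ge0// divr_ge0// ltW//.
have h3 : dl * (g x * ((lambda + eps) * c (v - x))) = g x * ((lambda + e') * c (v - x)).
  by rewrite /dl; field; rewrite gt_eqF.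
have h4 : g x * - dotv (x - v) (grad V x) <= g x * (CB - V x + lambda * c (v - x)).
  by rewrite ler_wpM2l// ltW.
lra.
Qed.

End pointwise_bound.

(** * The integrated bound on a cube *)

(** The integral of a nonnegative function is a supremum over the simple functions
    below it, so the comparison holds for arbitrary f and g; it is used with g the
    conjugate term, given only as a supremum of affine functions of the gradient. *)
Lemma ge0_le_nnintegral {d} {T : measurableType d} {R : realType}
    (m : {measure set T -> \bar R}) (f g : T -> \bar R) :
  (forall x, 0 <= f x)%E -> (forall x, f x <= g x)%E ->
  (\int[m]_x f x <= \int[m]_x g x)%E.
Proof.
move=> f0 fg; have g0 x : (0 <= g x)%E by exact: le_trans (fg x).
rewrite !ge0_integralTE//; apply: le_ereal_sup => _ [h /= hf <-].
by exists h => //= x; exact: le_trans (fg x).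
Qed.

Section cube_bound.
Context {R : realType} {n : nat}.
Variables (V c f : 'rV[R]_n -> R) (mu : probability 'rV[R]_n R).
Variables (lambda eps eta a b : R) (p q : 'rV[R]_n).
Hypothesis V_diff : forall x, differentiable V x.
Hypothesis f_diff : forall x, differentiable f x.
Hypothesis f_C1 : forall i, continuous (partial i f).
Hypothesis mu_density : forall A : set 'rV[R]_n, measurable A ->
  mu A = (\int[lebesgue_rV n]_(x in A) (expR (- V x))%:E)%E.
Hypothesis V_lower : forall x u : 'rV[R]_n,
  V (x + u) >= V x + dotv u (grad V x) - lambda * c u.
Hypotheses (lambda_ge0 : 0 <= lambda) (eps_gt0 : 0 < eps) (eta_gt0 : 0 < eta).
Hypotheses (c_ge0 : forall x, 0 <= c x) (c_even : forall x, c (- x) = c x).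
Hypotheses (c0 : c 0 = 0) (c_cont : continuous c).
Hypothesis ab : a < b.
Hypothesis pq_in : forall i, [/\ a <= p ord0 i, p ord0 i < q ord0 i & q ord0 i <= b].

(** Sums over the vertices, here and in max_vertices, stand for maxima, which they
    dominate. *)
Definition exp_vertices (x : 'rV[R]_n) : R :=
  \sum_(S : {set 'I_n}) expR ((lambda + eps) * c (box_vertex p q S - x)).

Definition max_vertices : R := \sum_(S : {set 'I_n}) `|V (box_vertex p q S)|.

Definition log_volume : R := \sum_(i < n) ln (q ord0 i - p ord0 i).

Lemma continuous_exp_vertices : continuous exp_vertices.
Proof.
have cS S : continuous (fun x : 'rV[R]_n => expR ((lambda + eps) * c (box_vertex p q S - x))).
  move=> x; pose v := box_vertex p q S.
  have h1 : v - y @[y --> x] --> v - x.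
    by apply: (@cvgB _ _ _ (nbhs x) _ (cst _) id); [exact: cvg_cst|exact: cvg_id].
  have h2 : c (v - y) @[y --> x] --> c (v - x) 
    by apply: cvg_comp; [exact: h1|exact: c_cont].
  have h3 : (lambda + eps) * c (v - y) @[y --> x] --> (lambda + eps) * c (v - x).
    exact: cvgMl_tmp h2.
  by apply: cvg_comp; [exact: h3|exact: continuous_expR].
by apply: continuous_big => //; exact: add_continuous.
Qed.

Let Q := cube a b : set 'rV[R]_n.
Let g x : R := f x ^+ 2 + eta.
Let Z : R := \int[mu]_x (\1_Q x * g x).
Let dl := (lambda + eps / 2) / (lambda + eps).
Let G := weighted f V eta.

Let mQ : measurable Q. Proof. exact: measurable_cube. Qed.
Let Qfin : (lebesgue_rV n Q < +oo)%E.
Proof. by rewrite lebesgue_cube ?ltry// ltW. Qed.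
Let muQ : (mu Q < +oo)%E.
Proof. by apply: (le_lt_trans (probability_le1 mu mQ)); rewrite ltry. Qed.

Let cV : continuous V. Proof. exact: differentiable_continuous_rV. Qed.
Let cf : continuous f. Proof. exact: differentiable_continuous_rV. Qed.
Let cg : continuous g.
Proof.
move=> x; apply: (@cvgD _ _ _ (nbhs x) _ (fun x => f x ^+ 2) (cst eta)).
  by apply: (@continuous_comp _ _ _ f (fun t : R => t ^+ 2));
    [exact: cf|exact: exprn_continuous].
exact: cvg_cst.
Qed.
Let g_gt0 x : 0 < g x. Proof. by rewrite ltr_wpDl ?sqr_ge0. Qed.

Let dG x : differentiable G x. Proof. exact: differentiable_weighted. Qed.
Let G_gt0 x : 0 < G x. Proof. by apply: mulr_gt0; [exact: g_gt0|exact: expR_gt0]. Qed.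

Let bounded_cube (a' b' : R) (h : 'rV[R]_n -> R) : continuous h ->
  exists K, forall x, cube a' b' x -> `|h x| <= K.
Proof.
by move=> ch; apply: compact_continuous_bounded;
  [exact: compact_cube|exact: continuous_subspaceT].
Qed.

Let cexpNV : continuous (fun x => expR (- V x)).
Proof.
move=> x; apply: (@continuous_comp _ _ _ (fun y => - V y) expR).
  by apply: (@cvgN _ _ _ (nbhs x) _ V (V x)); exact: cV.
exact: continuous_expR.
Qed.

Let dG_bounded i : exists K, forall x, cube (a - 1) (b + 1) x -> `|partial i G x| <= K.
Proof.
have [K1 h1] := @bounded_cube (a - 1) (b + 1) _ cf.
have [K2 h2] := @bounded_cube (a - 1) (b + 1) _ (@f_C1 i).
have [K3 h3] := @bounded_cube (a - 1) (b + 1) _ cg.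
have [K4 h4] := semiconvex_partial_bounded V_diff V_lower i (a - 1) (b + 1).
have [K5 h5] := @bounded_cube (a - 1) (b + 1) _ cexpNV.
exists ((2 * K1 * K2 + K3 * K4) * K5) => x Qx.
rewrite partial_weighted// normrM ler_pM// ?h5//.
rewrite (le_trans (ler_normB _ _))// lerD// !normrM.
  by rewrite ler_pM// ?h2// normr_nat ler_wpM2l// h1.
by rewrite ler_pM// ?h3// h4.
Qed.

Let mV : measurable_fun setT V. Proof. exact: continuous_measurable_rV. Qed.

Let bM (h k : 'rV[R]_n -> R) : bounded_on Q h -> continuous k -> bounded_on Q (fun x => h x * k x).
Proof.
move=> bh ck; have [K kK] := @bounded_cube a b _ ck.
exact: (bounded_onM bh (continuous_measurable_rV ck) kK).
Qed.

Let density (h : 'rV[R]_n -> R) : bounded_on Q h -> \int[mu]_x h x = \int[lebesgue_rV n]_x (h x * expR (- V x)).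
Proof.
have [K VK] := @bounded_cube a b _ cexpNV.
apply: (bint_density cV mu_density mQ Qfin (K := K)) => x Qx.
by rewrite (le_trans (ler_norm _))// VK.
Qed.

Let bg : bounded_on Q (fun x => \1_Q x * g x).
Proof. exact: bounded_on_cube. Qed.

Let ZE : Z = \int[lebesgue_rV n]_x (\1_Q x * G x).
Proof. by rewrite /Z density//; apply: eq_Rintegral => x _; rewrite mulrA. Qed.

(** The mass of (f^2 + eta) mu on the cube is that of a continuous positive
    density. *)
Lemma cube_mass_gt0 : 0 < Z.
Proof.
have Q_gt0 : (0 < lebesgue_rV n Q)%E.
  by rewrite /Q lebesgue_cube ?ltW// lte_fin exprn_gt0// subr_gt0.
have pG : pinched_on Q (fun x => \1_Q x * G x).
  by apply: pinched_on_cube => //; exact: differentiable_continuous_rV.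
by rewrite ZE; exact: (pinched_int_gt0 mQ Qfin Q_gt0 pG).
Qed.

Let Z_gt0 := cube_mass_gt0.
Let B0 x : R := \1_Q x * (g x * (ln (g x) - ln Z)).
Let BV x : R := \1_Q x * g x * V x.
Let BE x : R := \1_Q x * exp_vertices x.

Let bB0 : bounded_on Q B0.
Proof.
apply: bounded_on_cube => x.
have c1 : ln (g y) @[y --> x] --> ln (g x).
  by apply: cvg_comp; [exact: cg|exact: continuous_ln].
have c2 : ln (g y) - ln Z @[y --> x] --> ln (g x) - ln Z.
  by apply: (@cvgB _ _ _ (nbhs x) _ (fun y => ln (g y)) (cst (ln Z)));
    [exact: c1|exact: cvg_cst].
by apply: (@cvgM _ _ (nbhs x) _ g (fun y => ln (g y) - ln Z)); [exact: cg|exact: c2].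
Qed.
Let bBV : bounded_on Q BV. Proof. exact: bM. Qed.
Let bBE : bounded_on Q BE.
Proof. by apply: bounded_on_cube; exact: continuous_exp_vertices. Qed.

Let bdrift : bounded_on Q (fun x => \1_Q x * drift p q G x * expR (V x)).
Proof.
apply: bM; first exact: bounded_on_drift.
by move=> x; apply: continuous_comp; [exact: cV|exact: continuous_expR].
Qed.

Let entropyE : entropy (lebesgue_rV n) (fun x => \1_Q x * G x) =
  \int[mu]_x B0 x - \int[mu]_x BV x.
Proof.
rewrite -(bintB mQ muQ)// density; last exact: bounded_onB.
rewrite /entropy -ZE; apply: eq_Rintegral => x _.
rewrite /B0 /BV /G /weighted -/(g x) indicE.
case: (x \in Q); last by rewrite !mul0r subr0 mul0r.
rewrite !mul1r lnM ?posrE ?expR_gt0//= expRK; ring.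
Qed.

(* W is the excess of the drift over the terms that are integrated explicitly;
   by the pointwise bound its integral is at most that of the conjugate term. *)
Let W x : R := \1_Q x * drift p q G x * expR (V x) -
  (max_vertices * (\1_Q x * g x) - BV x + dl * (B0 x + Z * BE x)).

Let bR : bounded_on Q (fun x =>
  max_vertices * (\1_Q x * g x) - BV x + dl * (B0 x + Z * BE x)).
Proof.
apply: bounded_onD; first by apply: bounded_onB => //; exact: bounded_onZ.
by apply: bounded_onZ => //; apply: bounded_onD => //; exact: bounded_onZ.
Qed.

Let bW : bounded_on Q W. Proof. exact: bounded_onB. Qed.

Let W_le x : ((W x)%:E <= (eps / 2)%:E * fisher_density c f (eps / 4) x)%E.
Proof.
have [Qx|nQx] := pselect (Q x); last first.
  rewrite (bounded_on_out bW nQx) mule_ge0 ?lee_fin ?divr_ge0 ?(ltW eps_gt0)//.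
  exact: fisher_density_ge0.
have [S dS] := drift_vertex p q G x.
have h1 : V (box_vertex p q S) <= max_vertices.
  by rewrite /max_vertices (bigD1 S)//= (le_trans (ler_norm _))// lerDl sumr_ge0.
have h2 : expR ((lambda + eps) * c (box_vertex p q S - x)) <= exp_vertices x.
  by rewrite /exp_vertices (bigD1 S)//= lerDl sumr_ge0// => T _; exact: expR_ge0.
have := drift_pointwise V_diff f_diff V_lower lambda_ge0 eps_gt0 eta_gt0 c_ge0
  c_even h1 h2 Z_gt0.
apply: le_trans; rewrite lee_fin /W /B0 /BV /BE indicE mem_set// !mul1r dS.
rewrite le_eqVlt; apply/orP; left; apply/eqP; rewrite /dl /g; ring.
Qed.

(** [entropy_le_drift] for G = (f^2 + eta) e^(-V), rewritten as integrals against
    mu.  The integral of \1_Q * g * V appears on both sides and cancels. *)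
Lemma cube_bound (M : R) : (\int[mu]_x (exp_vertices x)%:E <= M%:E)%E ->
  (((1 - dl) * \int[mu]_x (\1_Q x * (g x * (ln (g x) - ln Z))) -
    Z * (max_vertices - log_volume + dl * M))%:E <=
  (eps / 2)%:E * \int[mu]_x fisher_density c f (eps / 4) x)%E.
Proof.
move=> EM.
have dl_ge0 : 0 <= dl.
  by rewrite divr_ge0// addr_ge0// ?(ltW eps_gt0)// divr_ge0// ltW.
have IE : \int[mu]_x BE x <= M.
  rewrite -lee_fin (bounded_on_EFin mQ muQ)//; apply: le_trans EM.
  apply: ge0_le_nnintegral => x; rewrite lee_fin.
    by rewrite mulr_ge0// sumr_ge0// => T _; exact: expR_ge0.
  rewrite /BE indicE; case: (_ \in _); rewrite ?mul1r// mul0r.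
  by rewrite sumr_ge0// => T _; exact: expR_ge0.
have main := @entropy_le_drift R n a b p q ab pq_in G dG G_gt0 dG_bounded.
rewrite entropyE -/log_volume -ZE in main.
have driftE : \int[lebesgue_rV n]_x (\1_Q x * drift p q G x) =
    \int[mu]_x (\1_Q x * drift p q G x * expR (V x)).
  rewrite density//; apply: eq_Rintegral => x _.
  by rewrite -[RHS]mulrA -expRD subrr expR0 mulr1.
have IW : \int[mu]_x W x = \int[mu]_x (\1_Q x * drift p q G x * expR (V x)) -
   (max_vertices * Z - \int[mu]_x BV x + dl * (\int[mu]_x B0 x + Z * \int[mu]_x BE x)).
  have bmg : bounded_on Q (fun x => max_vertices * (\1_Q x * g x)) by exact: bounded_onZ.
  have bZE : bounded_on Q (fun x => Z * BE x) by exact: bounded_onZ.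
  have bBZ : bounded_on Q (fun x => B0 x + Z * BE x) by exact: bounded_onD.
  have bdB : bounded_on Q (fun x => dl * (B0 x + Z * BE x)) by exact: bounded_onZ.
  have bmB : bounded_on Q (fun x => max_vertices * (\1_Q x * g x) - BV x).
    exact: bounded_onB.
  rewrite (bintB mQ muQ)// (bintD mQ muQ)// (bintB mQ muQ)// !(bintZ mQ muQ)//.
  by rewrite (bintD mQ muQ)// (bintZ mQ muQ).
rewrite -driftE in IW.
have W_int : ((\int[mu]_x W x)%:E <=
    (eps / 2)%:E * \int[mu]_x fisher_density c f (eps / 4) x)%E.
  have e0 : 0 < eps / 2 by rewrite divr_gt0.
  pose W' x := (eps / 2)^-1 * Num.max (W x) 0.
  have bW' : bounded_on Q W'.
    apply: bounded_onZ => //; split; first by apply: measurable_maxr => //; exact: bW.1.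
    have [K WK] := bW.2; exists K => x; apply: le_trans (WK x).
    by rewrite /Num.max; case: ifPn => // _; rewrite normr0.
  have h : (\int[mu]_x (W' x)%:E <= \int[mu]_x fisher_density c f (eps / 4) x)%E.
    apply: ge0_le_nnintegral => x.
      by rewrite lee_fin mulr_ge0 ?invr_ge0 ?(ltW e0)// le_max lexx orbT.
    rewrite EFinM lee_pdivrMl//; rewrite /Num.max; case: ifPn => // _.
    by rewrite mule_ge0 ?lee_fin ?(ltW e0)//; exact: fisher_density_ge0.
  apply: le_trans (lee_wpmul2l _ h); last by rewrite lee_fin ltW.
  rewrite -(bounded_on_EFin mQ muQ)// -EFinM lee_fin -(bintZ mQ muQ)//.
  apply: (bint_le mQ muQ) => //; first exact: bounded_onZ.
  by move=> x; rewrite /W' mulrA divff ?gt_eqF// mul1r le_max lexx.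
apply: le_trans W_int; rewrite lee_fin -/B0.
have h : dl * (Z * \int[mu]_x BE x) <= dl * (Z * M).
  by rewrite ler_wpM2l// ler_wpM2l// ltW.
rewrite (_ : \int[mu]_x _ = \int[mu]_x B0 x)//.
rewrite IW; move: main h; move: (\int[mu]_x B0 x) (\int[mu]_x BV x).
move: (\int[lebesgue_rV n]_x _) (\int[mu]_x BE x) => D E A B main h; lra.
Qed.

End cube_bound.

(** * Removing the regularization and the truncation *)

Section entropy_limits.
Context {d} {T : measurableType d} {R : realType}.
Variables (mu : probability T R) (h : T -> R) (Z : R).
Hypothesis mh : measurable_fun setT h.
Hypothesis h_ge0 : forall x, 0 <= h x.
Hypothesis hZ : (\int[mu]_x (h x)%:E)%E = Z%:E.
Hypothesis Z_gt0 : 0 < Z.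

Let xlnx_ge (u : R) : 0 <= u -> -1 <= u * ln u.
Proof.
rewrite le_eqVlt => /predU1P[<-|u0]; first by rewrite mul0r lerN10.
by have := log_sum_pointwise u0 ltr01; rewrite ln1 subr0; lra.
Qed.

Let xlnx_le (u : R) : 0 <= u -> u * ln u <= u * u.
Proof.
rewrite le_eqVlt => /predU1P[<-|u0]; first by rewrite !mul0r.
by rewrite ler_wpM2l ?(ltW u0)// ltW// ln_sublinear.
Qed.

(** With eta = s^2 the error eta ln eta is at least - 2 s. *)
Lemma xlnx_regularized (u s : R) : 0 <= u -> 0 < s ->
  u * ln u - 2 * s <= (u + s ^+ 2) * ln (u + s ^+ 2).
Proof.
move=> u0 s0; have s20 : 0 < s ^+ 2 by rewrite exprn_gt0.
have h1 : u * ln u <= u * ln (u + s ^+ 2).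
  move: u0; rewrite le_eqVlt => /predU1P[<-|u0]; first by rewrite !mul0r.
  by rewrite ler_wpM2l ?(ltW u0)// ler_ln ?posrE ?addr_gt0// lerDl ltW.
have h2 : s ^+ 2 * ln (s ^+ 2) <= s ^+ 2 * ln (u + s ^+ 2).
  by rewrite ler_wpM2l ?(ltW s20)// ler_ln ?posrE ?ltr_wpDl// lerDr.
have h3 : - (2 * s) <= s ^+ 2 * ln (s ^+ 2).
  have -> : s ^+ 2 * ln (s ^+ 2) = (2 * s) * (s * ln s).
    by rewrite lnXn// -mulr_natl; ring.
  by have := xlnx_ge (ltW s0); rewrite -(ler_pM2l (mulr_gt0 (ltr0Sn _ 1) s0)) mulrN1.
by rewrite mulrDl; lra.
Qed.

Lemma bounded_on_xlnx (Q : set T) (k : T -> R) : measurable Q ->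
  measurable_fun setT k -> (forall x, 0 <= k x) ->
  (exists M, forall x, Q x -> k x <= M) ->
  bounded_on Q (fun x => \1_Q x * (k x * ln (k x))).
Proof.
move=> mQ mk k0 [M kM]; apply: (@bounded_on_indic _ _ _ Q mQ _ (1 + M * M)).
  by apply: measurable_funM => //; exact: measurable_ln_comp.
move=> x Qx; have := xlnx_ge (k0 x); have := xlnx_le (k0 x).
have : k x * k x <= M * M by rewrite ler_pM// kM.
have : 0 <= M * M by rewrite mulr_ge0// (le_trans (k0 x) (kM _ Qx)).
by move=> *; rewrite ler_norml; apply/andP; split; lra.
Qed.

Lemma bounded_on_entropy (Q : set T) : measurable Q ->
  (exists M, forall x, Q x -> h x <= M) ->
  bounded_on Q (fun x => \1_Q x * (h x * (ln (h x) - ln Z))).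
Proof.
move=> mQ hM; rewrite (_ : (fun _ => _) = (fun x => \1_Q x * (h x * ln (h x)) -
    ln Z * (\1_Q x * h x))); last by apply/funext => x; ring.
apply: bounded_onB; first exact: bounded_on_xlnx.
have [M kM] := hM; apply: bounded_onZ => //.
by apply: (bounded_on_indic mQ mh (K := M)) => x Qx; rewrite ger0_norm ?kM.
Qed.

(** For eta = s^2 with s <= 1, the hypothesis gives the conclusion up to an error
    of at most a constant times s. *)
Lemma entropy_regularization (Q : set T) (kappa K J : R) :
  measurable Q -> (exists M, forall x, Q x -> h x <= M) ->
  0 < kappa -> 0 <= K ->
  (forall eta, 0 < eta -> 0 < \int[mu]_x (\1_Q x * (h x + eta))) ->
  (forall eta, 0 < eta ->
    kappa * \int[mu]_x (\1_Q x * ((h x + eta) *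
      (ln (h x + eta) - ln (\int[mu]_z (\1_Q z * (h z + eta)))))) <=
    \int[mu]_z (\1_Q z * (h z + eta)) * K + J) ->
  kappa * \int[mu]_x (\1_Q x * (h x * (ln (h x) - ln Z))) <= Z * K + J.
Proof.
move=> mQ [M hM] kappa0 K0 Zeta_gt0 bound.
have muQ : (mu Q < +oo)%E by apply: (le_lt_trans (probability_le1 mu mQ)); rewrite ltry.
have muQ1 : fine (mu Q) <= 1.
  by rewrite -lee_fin fineK ?ge0_fin_numE ?probability_le1.
have bh : bounded_on Q (fun x => \1_Q x * h x).
  by apply: (bounded_on_indic mQ mh (K := M)) => x Qx; rewrite ger0_norm ?hM.
have b0 := bounded_on_entropy mQ (ex_intro _ M hM).
have b1 := bounded_on_indic1 (R := R) mQ.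
have Ih : \int[mu]_x (\1_Q x * h x) <= Z.
  rewrite -lee_fin (bounded_on_EFin mQ muQ)// -hZ.
  apply: ge0_le_nnintegral => x; rewrite lee_fin ?mulr_ge0//.
  by rewrite indicE; case: (_ \in _); rewrite ?mul1r ?mul0r.
have step s : 0 < s -> s <= 1 ->
    kappa * \int[mu]_x (\1_Q x * (h x * (ln (h x) - ln Z))) <=
    Z * K + J + s * (K + kappa * (Z + 4)).
  move=> s0 s1; pose eta := s ^+ 2.
  have eta0 : 0 < eta by rewrite exprn_gt0.
  have etas : eta <= s by rewrite /eta expr2 ger_pMr.
  have eta1 : eta <= 1 by exact: le_trans s1.
  pose Ze := \int[mu]_z (\1_Q z * (h z + eta)).
  have Ze0 : 0 < Ze by exact: Zeta_gt0.
  have bhe : bounded_on Q (fun x => \1_Q x * (h x + eta)).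
    rewrite (_ : (fun _ => _) = (fun x => \1_Q x * h x + eta * \1_Q x)); last first.
      by apply/funext => x; ring.
    by apply: bounded_onD => //; exact: bounded_onZ.
  have ZeZ : Ze <= Z + eta.
    rewrite /Ze (_ : \int[mu]_z _ = \int[mu]_z (\1_Q z * h z + eta * \1_Q z)); last first.
      by apply: eq_Rintegral => x _; ring.
    rewrite (bintD mQ muQ)//; last exact: bounded_onZ.
    by rewrite (bintZ mQ muQ)// bint_indic// lerD// ger_pMr.
  have be : bounded_on Q (fun x => \1_Q x * ((h x + eta) * (ln (h x + eta) - ln Ze))).
    rewrite (_ : (fun _ => _) = (fun x => \1_Q x * ((h x + eta) * ln (h x + eta)) -
      ln Ze * (\1_Q x * (h x + eta)))); last by apply/funext => x; ring.
    apply: bounded_onB; last exact: bounded_onZ.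
    apply: bounded_on_xlnx => //; first exact: measurable_funD.
      by move=> x; rewrite addr_ge0// ltW.
    by exists (M + eta) => x Qx; rewrite lerD2r hM.
  have lnZe1 : ln Ze <= ln Z + Z^-1 * eta.
    have : ln Ze <= ln (Z + eta) by rewrite ler_ln ?posrE// addr_gt0.
    have -> : Z + eta = Z * (1 + Z^-1 * eta).
      by rewrite mulrDr mulr1 mulrA divff ?mul1r// gt_eqF.
    have ze0 : 0 < Z^-1 * eta by rewrite mulr_gt0 ?invr_gt0.
    rewrite lnM ?posrE ?addr_gt0// => h1.
    have h2 : ln (1 + Z^-1 * eta) <= Z^-1 * eta.
      by apply: le_ln1Dx; apply: lt_trans ze0; rewrite ltrN10.
    lra.
  have lnZe2 : ln Ze <= Z + 1.
    by rewrite (le_trans (ltW (ln_sublinear Ze0)))// (le_trans ZeZ)// lerD2l.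
  have bE : bounded_on Q (fun x => \1_Q x * (h x * (ln (h x) - ln Z)) -
      (Z^-1 * eta * (\1_Q x * h x) + (2 * s + eta * (Z + 1)) * \1_Q x)).
    apply: bounded_onB => //; apply: bounded_onD; exact: bounded_onZ.
  have pt : \int[mu]_x (\1_Q x * (h x * (ln (h x) - ln Z)) -
      (Z^-1 * eta * (\1_Q x * h x) + (2 * s + eta * (Z + 1)) * \1_Q x)) <=
    \int[mu]_x (\1_Q x * ((h x + eta) * (ln (h x + eta) - ln Ze))).
    apply: (bint_le mQ muQ) => // x; rewrite indicE.
    case: (x \in Q); last by rewrite !mul0r !mulr0 addr0 subrr.
    rewrite !mul1r mulr1.
    have h1 := xlnx_regularized (h_ge0 x) s0.
    have h2 : h x * ln Ze <= h x * (ln Z + Z^-1 * eta) by rewrite ler_wpM2l.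
    have h3 : eta * ln Ze <= eta * (Z + 1) by rewrite ler_wpM2l// ltW.
    move: h1 h2 h3; rewrite -/eta => h1 h2 h3; lra.
  have bhz : bounded_on Q (fun x => Z^-1 * eta * (\1_Q x * h x)) by exact: bounded_onZ.
  have b1z : bounded_on Q (fun x => (2 * s + eta * (Z + 1)) * \1_Q x : R).
    exact: bounded_onZ.
  have bDz := bounded_onD bhz b1z.
  rewrite (bintB mQ muQ)// (bintD mQ muQ)// !(bintZ mQ muQ)// bint_indic// in pt.
  have := bound eta eta0; rewrite -/Ze => bnd.
  have e1 : Z^-1 * eta * \int[mu]_x (\1_Q x * h x) <= s.
    apply: (@le_trans _ _ (Z^-1 * eta * Z)).
      by rewrite ler_wpM2l// mulr_ge0 ?invr_ge0 ?(ltW Z_gt0) ?(ltW eta0).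
    by rewrite mulrAC mulVf ?mul1r// gt_eqF.
  have e2 : (2 * s + eta * (Z + 1)) * fine (mu Q) <= 2 * s + s * (Z + 1).
    have h0 : 0 <= Z + 1 by rewrite addr_ge0 ?(ltW Z_gt0).
    apply: (@le_trans _ _ (2 * s + eta * (Z + 1))); last by rewrite lerD2l ler_wpM2r.
    by rewrite ger_pMr// addr_gt0// mulr_gt0// ltr_wpDl// ltW.
  have e3 : kappa * \int[mu]_x (\1_Q x * (h x * (ln (h x) - ln Z))) <=
      kappa * (\int[mu]_x (\1_Q x * ((h x + eta) * (ln (h x + eta) - ln Ze))) +
        s * (Z + 4)).
    by rewrite ler_wpM2l ?(ltW kappa0)//; lra.
  have e4 : Ze * K <= (Z + s) * K by rewrite ler_wpM2r// (le_trans ZeZ)// lerD2l.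
  move: e3 bnd e4; rewrite mulrDr; move: (\int[mu]_x _) (\int[mu]_x _) => A B.
  move=> e3 bnd e4; lra.
apply/ler_addgt0Pr => e e0.
pose C := K + kappa * (Z + 4).
have C0 : 0 <= C by rewrite addr_ge0// mulr_ge0 ?(ltW kappa0)// addr_ge0// ltW.
pose s := Num.min 1 (e / (C + 1)).
have C1 : 0 < C + 1 by rewrite ltr_wpDl.
have s0 : 0 < s by rewrite lt_min ltr01 divr_gt0.
have s1 : s <= 1 by rewrite ge_min lexx.
apply: le_trans (step s s0 s1) _; rewrite lerD2l -/C.
have : s <= e / (C + 1) by rewrite ge_min lexx orbT.
rewrite ler_pdivlMr// => /(le_trans _); apply.
by rewrite ler_wpM2l ?(ltW s0)// lerDl.
Qed.

(** Monotone convergence applies after adding Z, since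
    h (ln h - ln Z) >= h - Z >= - Z. *)
Lemma entropy_exhaustion (Q : nat -> set T) (B : R) :
  (forall k, measurable (Q k)) -> (forall k, exists M, forall x, Q k x -> h x <= M) ->
  (forall x k l, (k <= l)%N -> Q k x -> Q l x) -> (forall x, exists k, Q k x) ->
  (forall k, \int[mu]_x (\1_(Q k) x * (h x * (ln (h x) - ln Z))) <= B) ->
  (\int[mu]_x (h x * (ln (h x) - ln Z))%:E <= B%:E)%E.
Proof.
move=> mQ hQ ndQ exQ bound.
pose w x := h x * (ln (h x) - ln Z) + Z.
have w0 x : 0 <= w x.
  rewrite /w; have := h_ge0 x; rewrite le_eqVlt => /predU1P[<-|hx0].
    by rewrite mul0r add0r ltW.
  by have := log_sum_pointwise hx0 Z_gt0; lra.
have mE : measurable_fun setT (fun x => h x * (ln (h x) - ln Z)).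
  by apply: measurable_funM => //; apply: measurable_funB => //; exact: measurable_ln_comp.
have mw : measurable_fun setT w by exact: measurable_funD.
have Iw : (\int[mu]_x (w x)%:E <= (B + Z)%:E)%E.
  have wE x : limn (fun k => (\1_(Q k) x * w x)%:E) = (w x)%:E.
    apply/cvg_lim => //; have [k Qk] := exQ x.
    apply: cvg_near_cst; exists k => // l /= kl.
    by rewrite indicE mem_set ?mul1r//; exact: ndQ Qk.
  rewrite -(eq_integral _ _ (fun x _ => wE x)).
  have mk k : measurable_fun setT (fun x => (\1_(Q k) x * w x)%:E).
    by apply/measurable_EFinP; apply: measurable_funM.
  have k0 k x : setT x -> (0 <= (\1_(Q k) x * w x)%:E)%E.
    by move=> _; rewrite lee_fin mulr_ge0.
  have nd x : setT x -> {homo (fun k => (\1_(Q k) x * w x)%:E) : k l / (k <= l)%N >-> (k <= l)%E}.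
    move=> _ k l kl; rewrite lee_fin ler_wpM2r// !indicE ler_nat.
    have [Qk|//] := boolP (x \in Q k).
    by rewrite mem_set//; apply: (ndQ _ _ _ kl); rewrite inE in Qk.
  rewrite (monotone_convergence mu measurableT mk k0 nd).
  apply: lime_le; first by apply: (cvgP _ (cvg_monotone_convergence measurableT mk k0 nd)).
  apply: nearW => k.
  have muQ : (mu (Q k) < +oo)%E.
    by apply: (le_lt_trans (probability_le1 mu (mQ k))); rewrite ltry.
  have [M hM] := hQ k.
  have b0 : bounded_on (Q k) (fun x => \1_(Q k) x * (h x * (ln (h x) - ln Z))).
    exact: bounded_on_entropy.
  have b1 : bounded_on (Q k) (fun x => Z * \1_(Q k) x : R).
    by apply: bounded_onZ; exact: bounded_on_indic1.
  have -> : (\int[mu]_x (\1_(Q k) x * w x)%:E)%E =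
     (\int[mu]_x (\1_(Q k) x * (h x * (ln (h x) - ln Z)) + Z * \1_(Q k) x)%:E)%E.
    by apply: eq_integral => x _; congr EFin; rewrite /w; ring.
  rewrite -(bounded_on_EFin (mQ k) muQ); last exact: bounded_onD.
  rewrite (bintD (mQ k) muQ)// lee_fin lerD// (bintZ (mQ k) muQ); last exact: bounded_on_indic1.
  rewrite bint_indic// ger_pMr// -lee_fin fineK ?probability_le1//.
  by rewrite ge0_fin_numE.
have iw : mu.-integrable setT (fun x => (w x)%:E).
  apply/integrableP; split; first exact/measurable_EFinP.
  under eq_integral do rewrite gee0_abs ?lee_fin//.
  by apply: le_lt_trans Iw _; rewrite ltry.
have iZ : mu.-integrable setT (fun=> Z%:E) by exact: finite_measure_integrable_cst.
have -> : (\int[mu]_x (h x * (ln (h x) - ln Z))%:E)%E = (\int[mu]_x ((w x)%:E - Z%:E))%E.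
  by apply: eq_integral => x _; rewrite -EFinB; congr EFin; rewrite /w addrK.
by rewrite integralB// integral_cst//= probability_setT mule1 leeBlDr.
Qed.

Lemma Ent_integral : (\int[mu]_x ((h x)%:E * lne ((h x)%:E / \int[mu]_z (h z)%:E)))%E =
  (\int[mu]_x (h x * (ln (h x) - ln Z))%:E)%E.
Proof.
apply: eq_integral => x _; rewrite hZ.
have := h_ge0 x; rewrite le_eqVlt => /predU1P[<-|hx0]; first by rewrite mul0e mul0r.
rewrite /inve/= gt_eqF// -EFinM lne_EFin ?divr_gt0// -EFinM.
by rewrite ln_div ?posrE.
Qed.

End entropy_limits.

(** * Proof of the theorem *)

Section good_box.
Context {R : realType} {n : nat}.
Variables (V c : 'rV[R]_n -> R) (mu : probability 'rV[R]_n R) (kappa : R).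
Hypothesis V_cont : continuous V.
Hypothesis mu_density : forall A : set 'rV[R]_n, measurable A ->
  mu A = (\int[lebesgue_rV n]_(x in A) (expR (- V x))%:E)%E.
Hypotheses (c_cont : continuous c) (c_even : forall x, c (- x) = c x).
Hypothesis exp_moment :
  (\int[mu \x mu]_z (expR (kappa * c (z.2 - z.1)))%:E < +oo)%E.

Let measurable_exp_cost :
  measurable_fun setT (fun z : 'rV[R]_n * 'rV[R]_n => expR (kappa * c (z.2 - z.1))).
Proof.
apply: measurableT_comp => //; apply: measurable_funM => //.
apply: (measurableT_comp (continuous_measurable_rV c_cont)).
apply: measurable_fun_rVP => i.
rewrite (_ : (fun _ => _) = (fun z : 'rV[R]_n * 'rV[R]_n => z.2 ord0 i - z.1 ord0 i)).
  apply: measurable_funB.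
    exact: (measurableT_comp (measurable_coord i) measurable_snd).
  exact: (measurableT_comp (measurable_coord i) measurable_fst).
by apply/funext => z; rewrite !mxE.
Qed.

Let F (x : 'rV[R]_n) : \bar R := (\int[mu]_y (expR (kappa * c (y - x)))%:E)%E.

(** By Fubini the exponential moment centred at x is finite for mu-almost every
    x, hence for Lebesgue-almost every x. *)
Lemma exists_good_box : exists p q : 'rV[R]_n, (forall i, p ord0 i < q ord0 i) /\
  forall S, (\int[mu]_x (expR (kappa * c (box_vertex p q S - x)))%:E < +oo)%E.
Proof.
have mE : measurable_fun setT
    (fun z : 'rV[R]_n * 'rV[R]_n => (expR (kappa * c (z.2 - z.1)))%:E).
  exact/measurable_EFinP.
have E0 (z : 'rV[R]_n * 'rV[R]_n) : (0 <= (expR (kappa * c (z.2 - z.1)))%:E)%E.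
  by rewrite lee_fin expR_ge0.
have mF : measurable_fun setT F.
  exact: (measurable_fun_fubini_tonelli_F (m2 := mu) _ mE E0).
have F0 x : (0 <= F x)%E by apply: integral_ge0 => y _; rewrite lee_fin expR_ge0.
have iF : mu.-integrable setT F.
  apply/integrableP; split => //.
  under eq_integral do rewrite gee0_abs//.
  by move: exp_moment; rewrite (fubini_tonelli1 _ mE E0).
have Fneg : (lebesgue_rV n).-negligible [set x | ~ (F x \is a fin_num)].
  apply: (density_negligible V_cont mu_density).
  apply: negligibleS (integrable_ae measurableT iF) => x /= nF h; apply: nF.
  exact: h.
have [p [q [pq good]]] := negligible_box_vertices Fneg.
exists p, q; split => // S.
have Ffin : F (box_vertex p q S) \is a fin_num.
  apply: contrapT; apply: good => i; rewrite mxE.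
  by case: ifPn; [right|left].
have -> : (\int[mu]_x (expR (kappa * c (box_vertex p q S - x)))%:E)%E =
    F (box_vertex p q S).
  by apply: eq_integral => x _; rewrite -opprB c_even.
by rewrite -ge0_fin_numE.
Qed.

End good_box.

Theorem theorem5p16 (R : realType) (d : nat)
  (V : 'rV[R]_d -> R) (mu : probability 'rV[R]_d R)
  (V_diff : forall x, differentiable V x)
  (mu_density : forall A : set 'rV[R]_d, measurable A ->
    mu A = (\int[lebesgue_rV d]_(x in A) (expR (- V x))%:E)%E)
  (lambda : R) (lambda_ge0 : 0 <= lambda)
  (c : 'rV[R]_d -> R)
  (c_ge0 : forall x, 0 <= c x)
  (c_even : forall x, c (- x) = c x)
  (c_convex : strictly_convex c)
  (c0 : c 0 = 0)
  (V_lower : forall x u : 'rV[R]_d,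
    V (x + u) >= V x + dotv u (grad V x) - lambda * c u)
  (exp_moment : exists eps : R, 0 < eps /\
    (\int[mu \x mu]_p (expR ((lambda + eps) * c (p.2 - p.1)))%:E < +oo)%E) :
  exists K1 K2 K3 : R, [/\ 0 <= K1, 0 < K2, 0 <= K3 &
    forall f : 'rV[R]_d -> R, smooth f -> (forall x, 0 <= f x) ->
      (Ent mu (fun x => f x ^+ 2)%R <=
        K1%:E * \int[mu]_x
          (if (f x == 0)%R then 0
           else (f x ^+ 2)%:E *
             convex_conjugate c ((K2 * f x)^-1 *: grad f x)%R)
        + K3%:E * \int[mu]_x (f x ^+ 2)%:E)%E].
Proof.
have [eps [eps0 moment]] := exp_moment.
have c_cont : continuous c := convex_fun_continuous (strictly_convexW c_convex).
have V_cont : continuous V := differentiable_continuous_rV V_diff.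
have [p [q [pq fin_vertex]]] := exists_good_box V_cont mu_density c_cont c_even moment.
pose dl := (lambda + eps / 2) / (lambda + eps).
pose kappa := 1 - dl.
have le0 : 0 < lambda + eps by rewrite ltr_wpDl.
have kappa0 : 0 < kappa by rewrite /kappa /dl subr_gt0 ltr_pdivrMr// mul1r ltrD2l; lra.
have [M EM] : exists M, (\int[mu]_x (exp_vertices c lambda eps p q x)%:E <= M%:E)%E.
  suff : (\int[mu]_x (exp_vertices c lambda eps p q x)%:E < +oo)%E.
    move=> Efin; exists (fine (\int[mu]_x (exp_vertices c lambda eps p q x)%:E)).
    rewrite fineK// ge0_fin_numE//; apply: integral_ge0 => x _.
    by rewrite lee_fin sumr_ge0// => S _; exact: expR_ge0.
  rewrite /exp_vertices; under eq_integral do rewrite -sumEFin.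
  rewrite ge0_integral_sum//; last first.
    move=> S; apply/measurable_EFinP; apply: measurableT_comp => //.
    apply: measurable_funM => //; apply: continuous_measurable_rV => x.
    apply: (@cvg_comp _ _ _ (fun y : 'rV[R]_d => box_vertex p q S - y) c _
      (nbhs (box_vertex p q S - x))); last exact: c_cont.
    by apply: (@cvgB _ _ _ (nbhs x) _ (cst _) id); [exact: cvg_cst|exact: cvg_id].
  by apply: lte_sum_pinfty => S _; exact: fin_vertex.
pose K := `|max_vertices V p q - log_volume p q + dl * M|.
have K0 : 0 <= K by exact: normr_ge0.
exists (eps / 2 / kappa), (eps / 4), (K / kappa + 1); split.
- by rewrite !divr_ge0 ?(ltW kappa0) ?(ltW eps0).
- by rewrite divr_gt0.
- by rewrite addr_ge0// divr_ge0// ltW.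
move=> f f_smooth f_ge0.
have f_diff x : differentiable f x := f_smooth [::] x.
have f_C1 i : continuous (partial i f).
  exact: differentiable_continuous_rV (f_smooth [:: i]).
have f_cont := differentiable_continuous_rV f_diff.
pose h x := f x ^+ 2.
have h_cont : continuous h.
  by move=> x; apply: (@continuous_comp _ _ _ f (fun t : R => t ^+ 2));
    [exact: f_cont|exact: exprn_continuous].
have mh : measurable_fun setT h := continuous_measurable_rV h_cont.
have h0 x : 0 <= h x by exact: sqr_ge0.
pose I := (\int[mu]_x fisher_density c f (eps / 4) x)%E.
have I0 : (0 <= I)%E by apply: integral_ge0 => x _; exact: fisher_density_ge0.
change (Ent mu h <= (eps / 2 / kappa)%:E * I + (K / kappa + 1)%:E * \int[mu]_x (h x)%:E)%E.
have K1_gt0 : 0 < eps / 2 / kappa by rewrite !divr_gt0.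
have K3_gt0 : 0 < K / kappa + 1 by rewrite ltr_wpDl// divr_ge0// ltW.
have K1I0 : (0 <= (eps / 2 / kappa)%:E * I)%E.
  by apply: mule_ge0 => //; rewrite lee_fin ltW.
have intZ0 : (0 <= \int[mu]_x (h x)%:E)%E.
  by apply: integral_ge0 => x _; rewrite lee_fin.
(* a function of infinite mass makes the right-hand side infinite, as K3 > 0 *)
have [Zoo|Zfin] := eqVneq (\int[mu]_x (h x)%:E)%E +oo%E.
  rewrite Zoo gt0_muley ?lte_fin// addey ?leey//.
  by rewrite -ltNye; apply: lt_le_trans K1I0; rewrite ltNy0.
have hZ : (\int[mu]_x (h x)%:E)%E = (fine (\int[mu]_x (h x)%:E))%:E.
  by rewrite fineK// ge0_fin_numE// ltey.
move: (fine _) hZ => Z hZ; rewrite hZ in intZ0 *.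
move: intZ0; rewrite lee_fin le_eqVlt => /predU1P[Z0|Z_gt0].
  rewrite -Z0 mule0 adde0; apply: le_trans K1I0.
  rewrite /Ent hZ -Z0.
  (* division by a null mass yields +oo, so the integrand is +oo * h, which has
     integral +oo * 0 = 0 *)
  rewrite (eq_integral (fun x => (+oo * (h x)%:E)%E)); last first.
    move=> x _; rewrite inve0; have := h0 x; rewrite le_eqVlt => /predU1P[<-|hx0].
      by rewrite mul0e mule0.
    by rewrite gt0_muley ?lte_fin//= gt0_mulye ?gt0_muley ?lte_fin.
  rewrite ge0_integralZl//; [by rewrite hZ -Z0 mule0|exact/measurable_EFinP|].
  by move=> x _; rewrite lee_fin.
have [Ioo|Ifin] := eqVneq I +oo%E.
  by rewrite Ioo gt0_muley ?lte_fin// addye ?leey// -EFinM.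
have IE : I = (fine I)%:E by rewrite fineK// ge0_fin_numE// ltey.
move: (fine I) IE => J IE.
rewrite /Ent (Ent_integral h0 hZ Z_gt0) IE -!EFinM -EFinD.
(* cubes of half-side r k contain the box from the start and exhaust the space *)
pose B := `|p| + `|q|; pose k0 := Num.bound B.
have Bk0 : B < k0%:R by apply: le_lt_trans (archi_boundP _); rewrite ?ler_norm ?addr_ge0.
pose r k : R := (k0 + k)%:R + 1.
have r_gt0 k : 0 < r k by rewrite ltr_wpDl.
pose Q k : set 'rV[R]_d := cube (- r k) (r k).
have Qle k : exists M, forall x, Q k x -> h x <= M.
  have [L hL] := compact_continuous_bounded (@compact_cube R d (- r k) (r k))
    (continuous_subspaceT h_cont).
  by exists L => x Qx; rewrite (le_trans (ler_norm _))// hL.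
have rab k : - r k < r k by have := r_gt0 k; lra.
have pq_in k i : [/\ - r k <= p ord0 i, p ord0 i < q ord0 i & q ord0 i <= r k].
  have hp := norm_coord_le p i; have hq := norm_coord_le q i.
  have np := normr_ge0 p; have nq := normr_ge0 q.
  have kr : k0%:R <= r k by rewrite /r natrD -addrA lerDl addr_ge0.
  move: Bk0; rewrite /B; move: hp hq; rewrite !ler_norml => /andP[p1 p2] /andP[q1 q2] Bk0.
  by split => //; lra.
apply: (entropy_exhaustion mh h0 Z_gt0 (Q := Q)) => //.
- by move=> k; exact: measurable_cube.
- move=> x k l kl Qx i; have /andP[x1 x2] := Qx i.
  have : r k <= r l by rewrite lerD2r ler_nat leq_add2l.
  by move=> rkl; apply/andP; split; lra.
- move=> x; exists (Num.bound `|x|) => i.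
  have hx := norm_coord_le x i.
  have xb : `|x| < (Num.bound `|x|)%:R by exact: archi_boundP.
  have xr : `|x ord0 i| <= r (Num.bound `|x|).
    apply: le_trans hx (le_trans (ltW xb) _).
    by rewrite /r natrD addrAC lerDr addr_ge0.
  by rewrite -ler_norml.
- move=> k; rewrite -(ler_pM2l kappa0).
  have -> : kappa * (eps / 2 / kappa * J + (K / kappa + 1) * Z) =
      Z * K + (eps / 2 * J + kappa * Z) by field; rewrite gt_eqF.
  apply: (@le_trans _ _ (Z * K + eps / 2 * J)); last first.
    by rewrite lerD2l lerDl mulr_ge0// ltW.
  apply: (entropy_regularization mh h0 hZ Z_gt0 (Q := Q k)) => //.
  + exact: measurable_cube.
  + by move=> eta eta0; exact: cube_mass_gt0.
  + move=> eta eta0.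
    have := cube_bound V_diff f_diff f_C1 mu_density V_lower lambda_ge0 eps0 eta0
      c_ge0 c_even c0 c_cont (rab k) (pq_in k) EM.
    rewrite -/I IE -EFinM lee_fin -/dl -/kappa lerBlDl => /le_trans; apply.
    rewrite lerD2r ler_wpM2l ?ler_norm// ltW//; exact: cube_mass_gt0.
Qed.
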